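(* Let $\delta\in\{1,-1,0\}$ and let $\mathbf{M}_\delta$ be a spacelike Weingarten rotational surface in $\mathbb{S}^3_1$ (spherical for $\delta=1$, hyperbolic of the first kind for $\delta=-1$, parabolic for $\delta=0$), with profile curve parameterized by the principal curvature $\lambda$, whose principal curvatures satisfy $\kappa=-\lambda+2H$. Let $$\Phi_1(\lambda,\delta)=\phi_0\pm\frac{c^2}{\sqrt2}\int\frac{\lambda\,d\lambda}{\sqrt{H-\lambda}\,(c^2-2\delta(H-\lambda))\sqrt{(\lambda^2-1)c^2+2\delta(H-\lambda)}}$$ with constants $\phi_0$, $H$ and $c>0$. Then the coordinate functions of the profile curve of $\mathbf{M}_\delta$ with constant mean curvature $H$, parameterized with respect to $\lambda$, are given by one of the following cases. 1. For $\delta=1$: (a) $y(\lambda)=\frac{c}{\sqrt{2(H-\lambda)}}$, $z(\lambda)=\sqrt{1-y^2(\lambda)}\cosh\Phi_1(\lambda,1)$, $w(\lambda)=\sqrt{1-y^2(\lambda)}\sinh\Phi_1(\lambda,1)$ with $\lambda<H-\frac{c^2}{2}$; (b) $y(\lambda)=\frac{c}{\sqrt{2(H-\lambda)}}$, $z(\lambda)=\sqrt{y^2(\lambda)-1}\sinh\Phi_1(\lambda,1)$, $w(\lambda)=\sqrt{y^2(\lambda)-1}\cosh\Phi_1(\lambda,1)$ where i) $H-\frac{c^2}{2}<\lambda<H$ when $H\ge\frac12\left(c^2+\frac1{c^2}\right)$, or $1\le H<\frac12\left(c^2+\frac1{c^2}\right)$ for $c<1$, or $H\le-1$; ii) $H-\frac{c^2}{2}<\lambda<\frac{1-\sqrt{1-2Hc^2+c^4}}{c^2}$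 when $H<\frac{c^2}{2}$ or $\frac{c^2}{2}<H<\frac12\left(c^2+\frac1{c^2}\right)$; iii) $\frac{1+\sqrt{1-2Hc^2+c^4}}{c^2}<\lambda<H$ when $1<H<\frac12\left(c^2+\frac1{c^2}\right)$ for $c>1$. 2. For $\delta=-1$: $w(\lambda)=\frac{c}{\sqrt{2(H-\lambda)}}$, $x(\lambda)=\sqrt{1+w^2(\lambda)}\cos\Phi_1(\lambda,-1)$, $y(\lambda)=\sqrt{1+w^2(\lambda)}\sin\Phi_1(\lambda,-1)$ where i) $\lambda<H$ when $H\le-\frac1{c^2}$ for $c>1$; ii) $\lambda<\frac{-1-\sqrt{1+2Hc^2+c^4}}{c^2}$ when $-1\le H\le-\frac1{c^2}$ for $c\ge1$; iii) $\frac{-1+\sqrt{1+2Hc^2+c^4}}{c^2}<\lambda<H$ when $-\frac12\left(c^2+\frac1{c^2}\right)<H\le-1$ for $c<1$, or $H\ge1$ for $c>1$. 3. For $\delta=0$: $z(\lambda)=\frac{c}{\sqrt{2(H-\lambda)}}$, $x(\lambda)=\Phi_1(\lambda,0)z(\lambda)$, $w(\lambda)=\frac{1-x^2(\lambda)}{2z(\lambda)}$ where i) $\lambda<H$ when $H<-1$; ii) $\lambda<-1$ when $-1\le H\le1$; iii) $\lambda<-1$ or $1<\lambda<H$ when $H>1$.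
   Context: $\mathbb{E}^4_1$ is 4-dimensional Minkowski space with metric $\tilde g$, and $\mathbb{S}^3_1=\{\mathbf{x}\in\mathbb{E}^4_1:\tilde g(\mathbf{x},\mathbf{x})=1\}$ is de Sitter space. For $\delta=\pm1$ coordinates are used in which $\tilde g(\mathbf{x},\mathbf{y})=x_1y_1+x_2y_2+x_3y_3-x_4y_4$; for $\delta=0$, coordinates in which $\tilde g(\mathbf{x},\mathbf{y})=x_1y_1+x_2y_2+x_3y_4+x_4y_3$. Rotational surfaces $\mathbf{M}_\delta$, with $u\in J$ the arc length parameter of the profile curve $C$, $\tilde g(C',C')=\varepsilon=\pm1$, $'=d/du$: - Spherical, $\mathbf{M}_1$: $r(u,v)=(y\sin v,y\cos v,z,w)$, $v\in[0,2\pi]$, $y>0$, $y^2+z^2-w^2=1$, $y'^2+z'^2-w'^2=\varepsilon$; induced metric $\varepsilon du^2+y^2dv^2$; $z',w'$ nonzero. - Hyperbolic of the first kind, $\mathbf{M}_{-1}$: $r(u,v)=(x,y,w\sinh v,w\cosh v)$, $v\in\mathbb{R}$, $w>0$, $x^2+y^2-w^2=1$, $x'^2+y'^2-w'^2=\varepsilon$; induced metric $\varepsilon du^2+w^2dv^2$; $x',y'$ nonzero. - Parabolic, $\mathbf{M}_0$: $r(u,v)=(x,vz,z,-\tfrac12v^2z+w)$, $v\in\mathbb{R}$, $z>0$, $2zw+x^2=1$, $2z'w'+x'^2=\varepsilon$; induced metric $\varepsilon du^2+z^2dv^2$; $x',z'$ nonzero. Here $x,y,z,w$ are functions of $u$,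 and the surfaces are assumed not contained in a hyperplane of $\mathbb{E}^4_1$. The surface is spacelike if $\varepsilon=1$ and timelike if $\varepsilon=-1$. ''Parameterized with respect to $\lambda$'' means $\lambda$ replaces $u$ as parameter of the profile curve; the coordinate functions become functions of $\lambda$. Principal curvatures: with $N$ a unit normal field of the surface in $\mathbb{S}^3_1$, $\kappa=\tilde g(r_{uu},N)$ and $\lambda=\tilde g(r_{vv},N)/\tilde g(r_v,r_v)$; the eigenvalues of the shape operator are $\varepsilon\kappa,\lambda$, and the mean curvature is half its trace, $H=\frac12(\varepsilon\kappa+\lambda)$. Standing assumption: $\lambda$ ranges over an open interval on which $H-\lambda>0$, $c^2-2\delta(H-\lambda)\ne0$ and $(\lambda^2-1)c^2+2\delta(H-\lambda)>0$. The integral denotes an antiderivative in $\lambda$.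
   Formalization: For δ=1 a common sign ±1 on (z,w) is allowed, since (y,−z,−w) is also admissible; for δ=−1 the list of ranges i)–iii) is not exhaustive (e.g. H=0, c=1, λ<−1−√2), so the missing combinations of H, c and ranges are added as further cases. *)

(* Defs.v *)
From Stdlib Require Import Reals Lra.
From Coquelicot Require Import Coquelicot.
Local Open Scope R_scope.

(* Vectors of E^4_1, written in the coordinates (x1, x2, x3, x4). *)
Notation E41 := (R * R * R * R)%type.

Definition x1 (p : E41) : R := fst (fst (fst p)).
Definition x2 (p : E41) : R := snd (fst (fst p)).
Definition x3 (p : E41) : R := snd (fst p).
Definition x4 (p : E41) : R := snd p.

Inductive kind : Set := spherical | hyperbolic | parabolic.

Definition delta (k : kind) : R :=
  match k with spherical => 1 | hyperbolic => -1 | parabolic => 0 end.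

(* The metric in the coordinates attached to each kind: orthonormal for
   delta = 1, -1 and pseudo-orthonormal (null third and fourth axes) for
   delta = 0. *)
Definition gt (k : kind) (p q : E41) : R :=
  match k with
  | spherical | hyperbolic =>
      x1 p * x1 q + x2 p * x2 q + x3 p * x3 q - x4 p * x4 q
  | parabolic =>
      x1 p * x1 q + x2 p * x2 q + x3 p * x4 q + x4 p * x3 q
  end.

Definition de_Sitter (k : kind) (p : E41) : Prop := gt k p p = 1.

Definition Dvec (C : R -> E41) (t : R) : E41 :=
  (Derive (fun s => x1 (C s)) t, Derive (fun s => x2 (C s)) t,
   Derive (fun s => x3 (C s)) t, Derive (fun s => x4 (C s)) t).

Definition smooth_on (J : R -> Prop) (f : R -> R) : Prop :=
  forall (n : nat) (u : R), J u -> ex_derive_n f n u.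

Definition Rbar_interval (a b : Rbar) (t : R) : Prop :=
  Rbar_lt a t /\ Rbar_lt t b.

(* Coordinate functions of a profile curve.  A spherical surface uses
   (y, z, w), a hyperbolic one (x, y, w), a parabolic one (x, z, w); the
   remaining function plays no role. *)
Record coords : Type := Coords
  { cx : R -> R; cy : R -> R; cz : R -> R; cw : R -> R }.

Definition profile_curve (k : kind) (P : coords) (u : R) : E41 :=
  match k with
  | spherical => (0, cy P u, cz P u, cw P u)
  | hyperbolic => (cx P u, cy P u, 0, cw P u)
  | parabolic => (cx P u, 0, cz P u, cw P u)
  end.

Definition surf (k : kind) (P : coords) (u v : R) : E41 :=
  match k with
  | spherical => (cy P u * sin v, cy P u * cos v, cz P u, cw P u)
  | hyperbolic => (cx P u, cy P u, cw P u * sinh v, cw P u * cosh v)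
  | parabolic => (cx P u, v * cz P u, cz P u, - (1 / 2) * v ^ 2 * cz P u + cw P u)
  end.

Definition v_range (k : kind) (v : R) : Prop :=
  match k with spherical => 0 <= v <= 2 * PI | _ => True end.

(* The coordinate whose square is the coefficient of dv^2. *)
Definition radius (k : kind) (P : coords) : R -> R :=
  match k with spherical => cy P | hyperbolic => cw P | parabolic => cz P end.

Definition nonzero_derivatives (k : kind) (P : coords) (u : R) : Prop :=
  match k with
  | spherical => Derive (cz P) u <> 0 /\ Derive (cw P) u <> 0
  | hyperbolic => Derive (cx P) u <> 0 /\ Derive (cy P) u <> 0
  | parabolic => Derive (cx P) u <> 0 /\ Derive (cz P) u <> 0
  end.

Definition in_hyperplane (k : kind) (J : R -> Prop) (P : coords) : Prop :=
  exists (n : E41) (d : R), n <> (0, 0, 0, 0) /\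
    forall u v, J u -> v_range k v -> gt k n (surf k P u v) = d.

(* eps = 1: spacelike; eps = -1: timelike. *)
Record rotational_surface (k : kind) (eps : R) (J : R -> Prop) (P : coords)
  : Prop := {
  rs_smooth1 : smooth_on J (fun u => x1 (profile_curve k P u));
  rs_smooth2 : smooth_on J (fun u => x2 (profile_curve k P u));
  rs_smooth3 : smooth_on J (fun u => x3 (profile_curve k P u));
  rs_smooth4 : smooth_on J (fun u => x4 (profile_curve k P u));
  rs_radius : forall u, J u -> 0 < radius k P u;
  rs_de_Sitter : forall u, J u -> de_Sitter k (profile_curve k P u);
  rs_arclength : forall u, J u ->
    gt k (Dvec (profile_curve k P) u) (Dvec (profile_curve k P) u) = eps;
  rs_nonzero : forall u, J u -> nonzero_derivatives k P u;
  rs_full : ~ in_hyperplane k J P }.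

Definition r_u (k : kind) (P : coords) (u v : R) : E41 :=
  Dvec (fun s => surf k P s v) u.
Definition r_v (k : kind) (P : coords) (u v : R) : E41 :=
  Dvec (fun s => surf k P u s) v.
Definition r_uu (k : kind) (P : coords) (u v : R) : E41 :=
  Dvec (fun s => r_u k P s v) u.
Definition r_vv (k : kind) (P : coords) (u v : R) : E41 :=
  Dvec (fun s => r_v k P u s) v.

(* N is tangent to de Sitter space (orthogonal to the position vector); since
   de Sitter space is Lorentzian, its causal character is opposite to eps. *)
Record unit_normal_field (k : kind) (eps : R) (J : R -> Prop) (P : coords)
  (N : R * R -> E41) : Prop := {
  un_continuous :
    continuous_on (fun q : R * R => J (fst q) /\ v_range k (snd q)) N;
  un_position : forall u v, J u -> v_range k v -> gt k (N (u, v)) (surf k P u v) = 0;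
  un_u : forall u v, J u -> v_range k v -> gt k (N (u, v)) (r_u k P u v) = 0;
  un_v : forall u v, J u -> v_range k v -> gt k (N (u, v)) (r_v k P u v) = 0;
  un_unit : forall u v, J u -> v_range k v -> gt k (N (u, v)) (N (u, v)) = - eps }.

Definition kappa (k : kind) (P : coords) (N : R * R -> E41) (u v : R) : R :=
  gt k (r_uu k P u v) (N (u, v)).
Definition lambda (k : kind) (P : coords) (N : R * R -> E41) (u v : R) : R :=
  gt k (r_vv k P u v) (N (u, v)) / gt k (r_v k P u v) (r_v k P u v).

(* U is the inverse, defined on I, of the principal curvature lambda seen as a
   function on J; lambda does not depend on v. *)
Definition lambda_parameter (k : kind) (J I : R -> Prop) (P : coords)
  (N : R * R -> E41) (U : R -> R) : Prop :=
  (forall t, I t -> J (U t)) /\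
  (forall t v, I t -> v_range k v -> lambda k P N (U t) v = t) /\
  (forall u v, J u -> v_range k v ->
     I (lambda k P N u v) /\ U (lambda k P N u v) = u).

Definition reparam (P : coords) (U : R -> R) : coords :=
  {| cx := fun t => cx P (U t); cy := fun t => cy P (U t);
     cz := fun t => cz P (U t); cw := fun t => cw P (U t) |}.

Definition Phi1_integrand (dl H c t : R) : R :=
  t / (sqrt (H - t) * (c ^ 2 - 2 * dl * (H - t)) *
       sqrt ((t ^ 2 - 1) * c ^ 2 + 2 * dl * (H - t))).

Definition is_Phi1 (dl H c : R) (I : R -> Prop) (Phi : R -> R) : Prop :=
  exists (phi0 s : R) (F : R -> R),
    (s = 1 \/ s = -1) /\
    (forall t, I t -> is_derive F t (Phi1_integrand dl H c t)) /\
    (forall t, I t -> Phi t = phi0 + s * (c ^ 2 / sqrt 2) * F t).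

Definition radius_formula (H c t : R) : R := c / sqrt (2 * (H - t)).

(* (t^2 - 1) c^2 + 2 delta (H - t), a quadratic in t, has a double root when
   H = delta * Hcrit c, for delta = 1, -1. *)
Definition Hcrit (c : R) : R := 1 / 2 * (c ^ 2 + 1 / c ^ 2).

(* sg = -1 is the image of sg = 1 under the isometry (y, z, w) -> (y, -z, -w).
   The conditions y > 0 and y^2 + z^2 - w^2 = 1 leave the sign of z free when
   y < 1, and that of w when y > 1, so it has to be recorded here. *)
Definition spherical_inside (I : R -> Prop) (H c : R) (Q : coords) : Prop :=
  exists (Phi : R -> R) (sg : R),
    is_Phi1 1 H c I Phi /\ (sg = 1 \/ sg = -1) /\
    (forall t, I t ->
       cy Q t = radius_formula H c t /\
       cz Q t = sg * (sqrt (1 - cy Q t ^ 2) * cosh (Phi t)) /\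
       cw Q t = sg * (sqrt (1 - cy Q t ^ 2) * sinh (Phi t))) /\
    (forall t, I t -> t < H - c ^ 2 / 2).

Definition spherical_outside (I : R -> Prop) (H c : R) (Q : coords) : Prop :=
  exists (Phi : R -> R) (sg : R),
    is_Phi1 1 H c I Phi /\ (sg = 1 \/ sg = -1) /\
    (forall t, I t ->
       cy Q t = radius_formula H c t /\
       cz Q t = sg * (sqrt (cy Q t ^ 2 - 1) * sinh (Phi t)) /\
       cw Q t = sg * (sqrt (cy Q t ^ 2 - 1) * cosh (Phi t))) /\
    (   ((Hcrit c <= H \/ (1 <= H < Hcrit c /\ c < 1) \/ H <= -1) /\
         forall t, I t -> H - c ^ 2 / 2 < t < H)
     \/ ((H < c ^ 2 / 2 \/ c ^ 2 / 2 < H < Hcrit c) /\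
         forall t, I t ->
           H - c ^ 2 / 2 < t < (1 - sqrt (1 - 2 * H * c ^ 2 + c ^ 4)) / c ^ 2)
     \/ ((1 < H < Hcrit c /\ 1 < c) /\
         forall t, I t ->
           (1 + sqrt (1 - 2 * H * c ^ 2 + c ^ 4)) / c ^ 2 < t < H)).

Definition hyperbolic_ranges (I : R -> Prop) (H c : R) : Prop :=
     ((H <= - (1 / c ^ 2) /\ 1 < c) /\
      forall t, I t -> t < H)
  \/ ((-1 <= H <= - (1 / c ^ 2) /\ 1 <= c) /\
      forall t, I t -> t < (-1 - sqrt (1 + 2 * H * c ^ 2 + c ^ 4)) / c ^ 2)
  \/ (((- Hcrit c < H <= -1 /\ c < 1) \/ (1 <= H /\ 1 < c)) /\
      forall t, I t ->
        (-1 + sqrt (1 + 2 * H * c ^ 2 + c ^ 4)) / c ^ 2 < t < H).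

(* hyperbolic_ranges does not exhaust the intervals on which H - t and
   (t^2 - 1) c^2 - 2 (H - t) are positive: for H = 0, c = 1 these are the
   subintervals of t < -1 - sqrt 2, and no condition of that list holds.  The
   remaining (H, c) and ranges are exactly the following. *)
Definition hyperbolic_other_ranges (I : R -> Prop) (H c : R) : Prop :=
     (((H <= - Hcrit c /\ c < 1) \/ (H < -1 /\ c = 1)) /\
      forall t, I t -> t < H)
  \/ (((- Hcrit c < H /\ c < 1) \/ (- (1 / c ^ 2) < H /\ 1 <= c)) /\
      forall t, I t -> t < (-1 - sqrt (1 + 2 * H * c ^ 2 + c ^ 4)) / c ^ 2)
  \/ ((1 < H /\ c <= 1) /\
      forall t, I t ->
        (-1 + sqrt (1 + 2 * H * c ^ 2 + c ^ 4)) / c ^ 2 < t < H).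

Definition hyperbolic_case (I : R -> Prop) (H c : R) (Q : coords) : Prop :=
  exists Phi : R -> R,
    is_Phi1 (-1) H c I Phi /\
    (forall t, I t ->
       cw Q t = radius_formula H c t /\
       cx Q t = sqrt (1 + cw Q t ^ 2) * cos (Phi t) /\
       cy Q t = sqrt (1 + cw Q t ^ 2) * sin (Phi t)) /\
    (hyperbolic_ranges I H c \/ hyperbolic_other_ranges I H c).

Definition parabolic_case (I : R -> Prop) (H c : R) (Q : coords) : Prop :=
  exists Phi : R -> R,
    is_Phi1 0 H c I Phi /\
    (forall t, I t ->
       cz Q t = radius_formula H c t /\
       cx Q t = Phi t * cz Q t /\
       cw Q t = (1 - cx Q t ^ 2) / (2 * cz Q t)) /\
    (   (H < -1 /\ forall t, I t -> t < H)
     \/ (-1 <= H <= 1 /\ forall t, I t -> t < -1)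
     \/ (1 < H /\ forall t, I t -> t < -1 \/ 1 < t < H)).

Definition profile_cases (k : kind) (I : R -> Prop) (H c : R) (Q : coords) : Prop :=
  match k with
  | spherical => spherical_inside I H c Q \/ spherical_outside I H c Q
  | hyperbolic => hyperbolic_case I H c Q
  | parabolic => parabolic_case I H c Q
  end.

(* Main.v *)
Require Import Defs.
From Stdlib Require Import Reals Lra Ranalysis5.
From Coquelicot Require Import Coquelicot.
Local Open Scope R_scope.

(* Along v = 0 the surface is a unit speed curve C in a three-dimensional
   Lorentzian space, and its radius is f = <n, C> for a constant vector n with
   <n, n> = delta.  In the orthonormal frame (C, C', N), whose determinant is a
   constant sign sg by continuity of N, Gram determinants give
   lambda f = sg D and D^2 = f^2 + f'^2 - delta with D = det (n, C, C'), and
   (lambda f)' = kappa f'.  For kappa = 2 H - lambda the last equation is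
   f lambda' = 2 f' (H - lambda), so f^2 (H - lambda) is a constant c^2 / 2.
   The remaining two coordinates are determined by their polar (circular,
   hyperbolic or, for delta = 0, affine) angle, whose derivative is
   - D / (f^2 - delta); under the substitution t = lambda this is the integrand
   of Phi_1 up to a sign, constant because f' does not vanish where
   (lambda^2 - 1) c^2 + 2 delta (H - lambda) > 0.  Working in u throughout
   avoids differentiating the inverse U of lambda. *)

(* The vector for which [gt k (axis k)] of the profile curve is its radius; its
   square is [delta k]. *)
Definition axis (k : kind) : E41 :=
  match k with
  | spherical => (0, 1, 0, 0)
  | hyperbolic => (0, 0, 0, -1)
  | parabolic => (0, 0, 0, 1)
  end.

(** * Linear algebra in the Lorentzian three-space of the profile curve *)

Definition profile_plane (k : kind) (p : E41) : Prop :=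
  match k with
  | spherical => x1 p = 0
  | hyperbolic => x3 p = 0
  | parabolic => x2 p = 0
  end.

Definition det3 (a1 a2 a3 b1 b2 b3 c1 c2 c3 : R) : R :=
  a1 * (b2 * c3 - b3 * c2) - a2 * (b1 * c3 - b3 * c1) + a3 * (b1 * c2 - b2 * c1).

(** Each case drops the coordinate that vanishes on [profile_plane]. The Gram matrix of the three
    remaining axes has determinant -1 for every kind, null axes included, so one product identity
    serves all three. *)
Definition vol (k : kind) (p q r : E41) : R :=
  match k with
  | spherical => det3 (x2 p) (x3 p) (x4 p) (x2 q) (x3 q) (x4 q) (x2 r) (x3 r) (x4 r)
  | hyperbolic => det3 (x1 p) (x2 p) (x4 p) (x1 q) (x2 q) (x4 q) (x1 r) (x2 r) (x4 r)
  | parabolic => det3 (x1 p) (x3 p) (x4 p) (x1 q) (x3 q) (x4 q) (x1 r) (x3 r) (x4 r)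
  end.

Lemma gt_sym (k : kind) (p q : E41) : gt k p q = gt k q p.
Proof. destruct k; simpl; ring. Qed.

Lemma gt_axis_axis (k : kind) : gt k (axis k) (axis k) = delta k.
Proof. destruct k; simpl; unfold x1, x2, x3, x4; simpl; ring. Qed.

Lemma axis_plane (k : kind) : profile_plane k (axis k).
Proof. destruct k; reflexivity. Qed.

(* The Gram determinant identity in signature (2, 1). *)
Lemma vol_mul_vol (k : kind) (p q r p' q' r' : E41) :
  profile_plane k p -> profile_plane k q -> profile_plane k r ->
  profile_plane k p' -> profile_plane k q' -> profile_plane k r' ->
  vol k p q r * vol k p' q' r' =
  - det3 (gt k p p') (gt k p q') (gt k p r')
         (gt k q p') (gt k q q') (gt k q r')
         (gt k r p') (gt k r q') (gt k r r').
Proof.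
  destruct k; simpl; intros -> -> -> -> -> ->; unfold det3; ring.
Qed.

(** * The surface along the curve [v = 0] *)

Lemma zero_in_v_range (k : kind) : v_range k 0.
Proof. destruct k; simpl; auto. generalize PI_RGT_0; lra. Qed.

Lemma E41_eq (a b c d a' b' c' d' : R) :
  a = a' -> b = b' -> c = c' -> d = d' -> (a, b, c, d) = (a', b', c', d') :> E41.
Proof. now intros -> -> -> ->. Qed.

Lemma Dvec_ext (C C' : R -> E41) (t : R) :
  (forall s, C s = C' s) -> Dvec C t = Dvec C' t.
Proof.
  intros e; apply E41_eq; apply Derive_ext; intros s; now rewrite e.
Qed.

Lemma surf_0 (k : kind) (P : coords) (u : R) : surf k P u 0 = profile_curve k P u.
Proof.
  destruct k; simpl; apply E41_eq;
    rewrite ?sin_0, ?cos_0, ?sinh_0, ?cosh_0; ring.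
Qed.

Lemma r_u_0 (k : kind) (P : coords) (u : R) :
  r_u k P u 0 = Dvec (profile_curve k P) u.
Proof. apply Dvec_ext; intros s; apply surf_0. Qed.

Lemma r_uu_0 (k : kind) (P : coords) (u : R) :
  r_uu k P u 0 = Dvec (Dvec (profile_curve k P)) u.
Proof. apply Dvec_ext; intros s; apply r_u_0. Qed.

(** Stated for every [v], because [r_vv] differentiates this expression in [v] once more. *)
Lemma r_v_eq (k : kind) (P : coords) (u v : R) :
  r_v k P u v =
  match k with
  | spherical => (cy P u * cos v, - (cy P u * sin v), 0, 0)
  | hyperbolic => (0, 0, cw P u * cosh v, cw P u * sinh v)
  | parabolic => (0, cz P u, 0, - v * cz P u)
  end.
Proof.
  destruct k; apply E41_eq; apply is_derive_unique; unfold x1, x2, x3, x4; simpl;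
    auto_derive; auto; field.
Qed.

Lemma r_vv_0 (k : kind) (P : coords) (u : R) :
  r_vv k P u 0 =
  match k with
  | spherical => (0, - cy P u, 0, 0)
  | hyperbolic => (0, 0, 0, cw P u)
  | parabolic => (0, 0, 0, - cz P u)
  end.
Proof.
  unfold r_vv; erewrite Dvec_ext; [|intros s; apply r_v_eq].
  destruct k; apply E41_eq; apply is_derive_unique; unfold x1, x2, x3, x4; simpl;
    auto_derive; auto; rewrite ?sin_0, ?cos_0, ?sinh_0, ?cosh_0; field.
Qed.

Lemma gt_axis_profile (k : kind) (P : coords) (u : R) :
  gt k (axis k) (profile_curve k P u) = radius k P u.
Proof. destruct k; simpl; unfold x1, x2, x3, x4; simpl; ring. Qed.

Lemma profile_curve_plane (k : kind) (P : coords) (u : R) :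
  profile_plane k (profile_curve k P u).
Proof. destruct k; reflexivity. Qed.

Lemma Dvec_plane (k : kind) (C : R -> E41) (u : R) :
  (forall s, profile_plane k (C s)) -> profile_plane k (Dvec C u).
Proof.
  destruct k; simpl; intros h; unfold x1, x2, x3; simpl;
    (erewrite Derive_ext; [apply Derive_const|]); exact h.
Qed.

(** At [v = 0] the vector [r_vv] is [- radius] times [axis], and [r_v] has square [radius ^ 2]. *)
Lemma lambda_0 (k : kind) (P : coords) (N : R * R -> E41) (u : R) :
  radius k P u <> 0 ->
  lambda k P N u 0 = - gt k (axis k) (N (u, 0)) / radius k P u.
Proof.
  intros h; unfold lambda; rewrite r_vv_0, r_v_eq.
  destruct k; simpl in *; unfold x1, x2, x3, x4; simpl;
    rewrite ?sin_0, ?cos_0, ?sinh_0, ?cosh_0; field; exact h.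
Qed.

(** At [v = 0] the vector [r_v] is [radius] times the coordinate vector orthogonal to
    [profile_plane], so what is orthogonal to [r_v] lies in that subspace. *)
Lemma normal_plane (k : kind) (P : coords) (N : E41) (u : R) :
  radius k P u <> 0 -> gt k N (r_v k P u 0) = 0 -> profile_plane k N.
Proof.
  rewrite r_v_eq; destruct k; simpl; unfold x1, x2, x3, x4; simpl;
    rewrite ?sin_0, ?cos_0, ?sinh_0, ?cosh_0; intros h e;
    apply Rmult_eq_reg_r with (2 := h); lra.
Qed.

(** * Derivatives of scalar products and determinants *)

Lemma is_derive_Rmult (f g : R -> R) (t df dg : R) :
  is_derive f t df -> is_derive g t dg ->
  is_derive (fun s => f s * g s) t (df * g t + f t * dg).
Proof. intros hf hg; apply (is_derive_mult f g t df dg hf hg Rmult_comm). Qed.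

Lemma is_derive_Rplus (f g : R -> R) (t df dg : R) :
  is_derive f t df -> is_derive g t dg ->
  is_derive (fun s => f s + g s) t (df + dg).
Proof. intros hf hg; apply (is_derive_plus f g t df dg hf hg). Qed.

Lemma is_derive_Rminus (f g : R -> R) (t df dg : R) :
  is_derive f t df -> is_derive g t dg ->
  is_derive (fun s => f s - g s) t (df - dg).
Proof. intros hf hg; apply (is_derive_minus f g t df dg hf hg). Qed.

Lemma is_derive_Rcomp (f g : R -> R) (t df dg : R) :
  is_derive f (g t) df -> is_derive g t dg ->
  is_derive (fun s => f (g s)) t (dg * df).
Proof. intros hf hg; apply (is_derive_comp f g t df dg hf hg). Qed.

Lemma is_derive_Rconst (a t : R) : is_derive (fun _ => a) t 0.
Proof. apply @is_derive_const. Qed.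

(** Differentiates polynomial expressions whose leaves are known only through hypotheses. The
    derivative comes out as an existential variable, compared with the wanted one after [evar_last];
    the rules above keep it in real arithmetic, ready for [ring] and [field]. *)
Ltac derive_arith :=
  match goal with
  | |- is_derive (fun s => @?f s + @?g s) _ _ => apply (is_derive_Rplus f g); derive_arith
  | |- is_derive (fun s => @?f s - @?g s) _ _ => apply (is_derive_Rminus f g); derive_arith
  | |- is_derive (fun s => @?f s * @?g s) _ _ => apply (is_derive_Rmult f g); derive_arith
  | |- is_derive (fun _ => ?a) _ _ => apply is_derive_Rconst
  | |- _ => eassumption
  end.

Definition is_derive_vec (A : R -> E41) (t : R) (T : E41) : Prop :=
  (is_derive (fun s => x1 (A s)) t (x1 T) /\ is_derive (fun s => x2 (A s)) t (x2 T)) /\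
  is_derive (fun s => x3 (A s)) t (x3 T) /\ is_derive (fun s => x4 (A s)) t (x4 T).

Lemma is_derive_vec_const (p : E41) (t : R) : is_derive_vec (fun _ => p) t (0, 0, 0, 0).
Proof. split; split; apply is_derive_Rconst. Qed.

Lemma is_derive_gt (k : kind) (A B : R -> E41) (t : R) (A' B' : E41) :
  is_derive_vec A t A' -> is_derive_vec B t B' ->
  is_derive (fun s => gt k (A s) (B s)) t (gt k A' (B t) + gt k (A t) B').
Proof.
  intros [[a1 a2] [a3 a4]] [[b1 b2] [b3 b4]].
  destruct k; unfold gt; (evar_last; [derive_arith | simpl; ring]).
Qed.

Lemma is_derive_vol (k : kind) (p : E41) (A B : R -> E41) (t : R) (A' B' : E41) :
  is_derive_vec A t A' -> is_derive_vec B t B' ->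
  is_derive (fun s => vol k p (A s) (B s)) t (vol k p A' (B t) + vol k p (A t) B').
Proof.
  intros [[a1 a2] [a3 a4]] [[b1 b2] [b3 b4]].
  destruct k; unfold vol, det3; (evar_last; [derive_arith | simpl; ring]).
Qed.

Lemma profile_is_derive (k : kind) (eps : R) (J : R -> Prop) (P : coords) (u : R) :
  rotational_surface k eps J P -> J u ->
  is_derive_vec (profile_curve k P) u (Dvec (profile_curve k P) u) /\
  is_derive_vec (Dvec (profile_curve k P)) u (Dvec (Dvec (profile_curve k P)) u).
Proof.
  intros hM hu; split; split; split; apply Derive_correct.
  - exact (rs_smooth1 _ _ _ _ hM 1%nat u hu).
  - exact (rs_smooth2 _ _ _ _ hM 1%nat u hu).
  - exact (rs_smooth3 _ _ _ _ hM 1%nat u hu).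
  - exact (rs_smooth4 _ _ _ _ hM 1%nat u hu).
  - exact (rs_smooth1 _ _ _ _ hM 2%nat u hu).
  - exact (rs_smooth2 _ _ _ _ hM 2%nat u hu).
  - exact (rs_smooth3 _ _ _ _ hM 2%nat u hu).
  - exact (rs_smooth4 _ _ _ _ hM 2%nat u hu).
Qed.

(** * Constancy and sign on open intervals *)

Lemma Rbar_interval_locally (a b : Rbar) (t : R) :
  Rbar_interval a b t -> locally t (Rbar_interval a b).
Proof.
  intros [ha hb].
  exact (locally_interval _ t a b ha hb (fun y h1 h2 => conj h1 h2)).
Qed.

Lemma Rbar_interval_convex (a b : Rbar) (s t z : R) :
  Rbar_interval a b s -> Rbar_interval a b t -> s <= z <= t -> Rbar_interval a b z.
Proof.
  intros [hs _] [_ ht] [hsz hzt]; split.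
  - apply Rbar_lt_le_trans with (1 := hs); exact hsz.
  - apply Rbar_le_lt_trans with (2 := ht); exact hzt.
Qed.

Lemma derive_of_constant (a b : Rbar) (f : R -> R) (K t df : R) :
  (forall s, Rbar_interval a b s -> f s = K) -> Rbar_interval a b t ->
  is_derive f t df -> df = 0.
Proof.
  intros hf ht h.
  rewrite <- (is_derive_unique _ _ _ h).
  rewrite (Derive_ext_loc f (fun _ => K)); [apply Derive_const|].
  generalize (Rbar_interval_locally a b t ht); apply filter_imp; exact hf.
Qed.

Lemma constant_of_derive (a b : Rbar) (f : R -> R) (s t : R) :
  (forall z, Rbar_interval a b z -> is_derive f z 0) ->
  Rbar_interval a b s -> Rbar_interval a b t -> f s = f t.
Proof.
  intros hf hs ht.
  destruct (Rtotal_order s t) as [h|[->|h]]; auto; [|symmetry];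
    apply (eq_is_derive f); auto; intros z hz; apply hf;
    [apply (Rbar_interval_convex a b s t) | apply (Rbar_interval_convex a b t s)]; auto.
Qed.

(** By the intermediate value theorem, a change of sign would produce a zero inside the interval. *)
Lemma constant_sign (a b : Rbar) (f : R -> R) :
  (forall z, Rbar_interval a b z -> continuity_pt f z /\ f z <> 0) ->
  exists s : R, (s = 1 \/ s = -1) /\ forall z, Rbar_interval a b z -> 0 < s * f z.
Proof.
  intros hf.
  assert (no_change : forall (g : R -> R) (p q : R),
    (forall z, Rbar_interval a b z -> continuity_pt g z /\ g z <> 0) ->
    Rbar_interval a b p -> Rbar_interval a b q -> p < q -> ~ (g p < 0 /\ 0 < g q)).
  { intros g p q hg hp hq hpq [h1 h2].
    destruct (IVT_interv g p q) as [z [hz e]]; auto.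
    - intros z hz; apply hg; apply (Rbar_interval_convex a b p q); auto.
    - apply (proj2 (hg z (Rbar_interval_convex a b p q z hp hq hz)) e). }
  (* [no_change] only forbids passing from negative to positive; the reverse passage is treated
     through [- f]. *)
  assert (hopp : forall z, Rbar_interval a b z ->
    continuity_pt (fun s => - f s) z /\ - f z <> 0).
  { intros z hz; destruct (hf z hz) as [h1 h2]; split; [|lra].
    now apply (continuity_pt_opp f). }
  destruct (Classical_Prop.classic (exists p, Rbar_interval a b p /\ 0 < f p))
    as [[p [hp fp]]|none].
  - exists 1; split; auto; intros q hq.
    destruct (Rtotal_order 0 (f q)) as [h|[h|h]]; [lra| |].
    + destruct (hf q hq); congruence.
    + destruct (Rtotal_order p q) as [h'|[->|h']]; [| lra |].
      * destruct (no_change (fun s => - f s) p q); auto; lra.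
      * destruct (no_change f q p); auto.
  - exists (-1); split; auto; intros q hq.
    destruct (Rtotal_order 0 (f q)) as [h|[h|h]]; [| |lra].
    + destruct none; eauto.
    + destruct (hf q hq); congruence.
Qed.

(** An empty [J] would satisfy [in_hyperplane] vacuously, against [rs_full]. The point so obtained
    is where constants of integration are read off. *)
Lemma rotational_surface_inhabited (k : kind) (eps : R) (J : R -> Prop) (P : coords) :
  rotational_surface k eps J P -> exists u, J u.
Proof.
  intros hM; apply Classical_Prop.NNPP; intros none; apply (rs_full _ _ _ _ hM).
  exists (1, 0, 0, 0), 0; split.
  - intros e; injection e; lra.
  - intros u v hu; destruct none; eauto.
Qed.

(** * Continuity of the normal field along [v = 0] *)

Lemma continuous_coordinates (p : E41) :
  (continuous x1 p /\ continuous x2 p) /\ continuous x3 p /\ continuous x4 p.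
Proof.
  assert (c4 : continuous x4 p) by (destruct p; apply continuous_snd).
  assert (c3 : continuous x3 p).
  { apply (continuous_comp fst snd); destruct p as [[p p3] p4];
      [apply continuous_fst | apply continuous_snd]. }
  assert (c12 : continuous (fun q : E41 => fst (fst q)) p).
  { apply (continuous_comp fst fst); destruct p as [[p p3] p4]; apply continuous_fst. }
  repeat split; auto.
  - apply (continuous_comp (fun q : E41 => fst (fst q)) fst); auto.
    destruct p as [[[p1 p2] p3] p4]; apply continuous_fst.
  - apply (continuous_comp (fun q : E41 => fst (fst q)) snd); auto.
    destruct p as [[[p1 p2] p3] p4]; apply continuous_snd.
Qed.

(** For the spherical kind [v = 0] is an end point of the range of [v], so [N] is only continuous
    within its domain. The path [s -> (s, 0)] stays in that domain near [u], which is enough. *)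
Lemma continuity_pt_normal (a b : Rbar) (k : kind) (N : R * R -> E41)
  (pr : E41 -> R) (u : R) :
  (forall p, continuous pr p) ->
  continuous_on (fun q : R * R => Rbar_interval a b (fst q) /\ v_range k (snd q)) N ->
  Rbar_interval a b u -> continuity_pt (fun s => pr (N (s, 0))) u.
Proof.
  intros hpr hN hu; apply continuity_pt_filterlim.
  apply (filterlim_comp _ _ _ (fun s => N (s, 0)) pr _ (locally (N (u, 0)))).
  2: apply hpr.
  apply (filterlim_comp _ _ _ (fun s => (s, 0)) N _
    (within (fun q : R * R => Rbar_interval a b (fst q) /\ v_range k (snd q))
            (locally (u, 0)))).
  2: apply hN; split; auto using zero_in_v_range.
  intros Q [eps hQ].
  unfold filtermap.
  generalize (filter_and _ _ (Rbar_interval_locally a b u hu) (locally_ball u eps)).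
  apply filter_imp; intros s [h1 h2]; apply hQ.
  - split; [exact h2 | apply ball_center].
  - split; auto using zero_in_v_range.
Qed.

Lemma continuity_pt_vol (a b : Rbar) (k : kind) (N : R * R -> E41)
  (A B : R -> E41) (u : R) (A' B' : E41) :
  is_derive_vec A u A' -> is_derive_vec B u B' ->
  continuous_on (fun q : R * R => Rbar_interval a b (fst q) /\ v_range k (snd q)) N ->
  Rbar_interval a b u -> continuity_pt (fun s => vol k (A s) (B s) (N (s, 0))) u.
Proof.
  intros [[a1 a2] [a3 a4]] [[b1 b2] [b3 b4]] hN hu.
  assert (hd : forall f : R -> R, forall l, is_derive f u l -> continuity_pt f u).
  { intros f l h; apply continuity_pt_filterlim.
    apply (ex_derive_continuous f); now exists l. }
  apply hd in a1, a2, a3, a4, b1, b2, b3, b4.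
  assert (h1 : continuity_pt (fun s => x1 (N (s, 0))) u).
  { apply (continuity_pt_normal a b k); auto; apply continuous_coordinates. }
  assert (h2 : continuity_pt (fun s => x2 (N (s, 0))) u).
  { apply (continuity_pt_normal a b k); auto; apply continuous_coordinates. }
  assert (h3 : continuity_pt (fun s => x3 (N (s, 0))) u).
  { apply (continuity_pt_normal a b k); auto; apply continuous_coordinates. }
  assert (h4 : continuity_pt (fun s => x4 (N (s, 0))) u).
  { apply (continuity_pt_normal a b k); auto; apply continuous_coordinates. }
  assert (hm : forall f g : R -> R, continuity_pt f u -> continuity_pt g u ->
    continuity_pt (fun s => f s * g s) u) by (intros; now apply continuity_pt_mult).
  assert (hp : forall f g : R -> R, continuity_pt f u -> continuity_pt g u ->
    continuity_pt (fun s => f s + g s) u) by (intros; now apply continuity_pt_plus).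
  assert (hs : forall f g : R -> R, continuity_pt f u -> continuity_pt g u ->
    continuity_pt (fun s => f s - g s) u) by (intros; now apply continuity_pt_minus).
  destruct k; unfold vol, det3; auto 8.
Qed.

(** * Differential equations of the profile curve *)

Definition angular (k : kind) (P : coords) (u : R) : R :=
  vol k (axis k) (profile_curve k P u) (Dvec (profile_curve k P) u).

Definition radius' (k : kind) (P : coords) (u : R) : R :=
  gt k (axis k) (Dvec (profile_curve k P) u).

Lemma gt_axis_is_derive (k : kind) (A : R -> E41) (u : R) (T : E41) :
  is_derive_vec A u T -> is_derive (fun s => gt k (axis k) (A s)) u (gt k (axis k) T).
Proof.
  intros h; evar_last.
  - apply is_derive_gt; [apply is_derive_vec_const | exact h].
  - destruct k; unfold gt, x1, x2, x3, x4; simpl; ring.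
Qed.

Lemma radius_is_derive (k : kind) (eps : R) (J : R -> Prop) (P : coords) (u : R) :
  rotational_surface k eps J P -> J u -> is_derive (radius k P) u (radius' k P u).
Proof.
  intros hM hu; apply (is_derive_ext _ _ _ _ (gt_axis_profile k P)).
  apply gt_axis_is_derive; apply (profile_is_derive _ _ _ _ _ hM hu).
Qed.

Lemma continuity_pt_radius' (k : kind) (eps : R) (J : R -> Prop) (P : coords) (u : R) :
  rotational_surface k eps J P -> J u -> continuity_pt (radius' k P) u.
Proof.
  intros hM hu; apply continuity_pt_filterlim.
  apply (ex_derive_continuous (radius' k P)); eexists.
  apply gt_axis_is_derive; apply (profile_is_derive _ _ _ _ _ hM hu).
Qed.

(** The product rule gives det (n, C', C') + det (n, C, C''), and the first term vanishes. *)
Lemma angular_is_derive (k : kind) (eps : R) (J : R -> Prop) (P : coords) (u : R) :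
  rotational_surface k eps J P -> J u ->
  is_derive (angular k P) u
    (vol k (axis k) (profile_curve k P u) (Dvec (Dvec (profile_curve k P)) u)).
Proof.
  intros hM hu; destruct (profile_is_derive _ _ _ _ _ hM hu) as [h1 h2]; evar_last.
  - apply is_derive_vol; [exact h1 | exact h2].
  - destruct k; unfold vol, det3; ring.
Qed.

(** Each relation comes from differentiating a constant: [<C, C> = 1], then [<C, C'> = 0], and
    [<C', C'> = eps]. *)
Lemma profile_gram (k : kind) (eps : R) (a b : Rbar) (P : coords) (u : R)
  (C := profile_curve k P) :
  rotational_surface k eps (Rbar_interval a b) P -> Rbar_interval a b u ->
  gt k (C u) (Dvec C u) = 0 /\
  gt k (C u) (Dvec (Dvec C) u) = - eps /\
  gt k (Dvec C u) (Dvec (Dvec C) u) = 0.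
Proof.
  intros hM hu.
  assert (CT : forall s, Rbar_interval a b s -> gt k (C s) (Dvec C s) = 0).
  { intros s hs; destruct (profile_is_derive _ _ _ _ _ hM hs) as [h1 h2].
    assert (e := derive_of_constant a b _ 1 s _ (rs_de_Sitter _ _ _ _ hM) hs
                   (is_derive_gt k _ _ _ _ _ h1 h1)).
    rewrite (gt_sym k (Dvec _ s)) in e; unfold C; lra. }
  destruct (profile_is_derive _ _ _ _ _ hM hu) as [h1 h2].
  assert (TT := rs_arclength _ _ _ _ hM u hu).
  repeat split; auto.
  - assert (e := derive_of_constant a b _ 0 u _ CT hu (is_derive_gt k _ _ _ _ _ h1 h2)).
    unfold C; lra.
  - assert (e := derive_of_constant a b _ eps u _ (rs_arclength _ _ _ _ hM) hu
                   (is_derive_gt k _ _ _ _ _ h2 h2)).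
    rewrite (gt_sym k (Dvec (Dvec _) u)) in e; unfold C; lra.
Qed.

Lemma principal_curvature_equations (k : kind) (H : R) (a b : Rbar) (P : coords)
  (N : R * R -> E41) :
  rotational_surface k 1 (Rbar_interval a b) P ->
  unit_normal_field k 1 (Rbar_interval a b) P N ->
  (forall u v, Rbar_interval a b u -> v_range k v ->
     kappa k P N u v = - lambda k P N u v + 2 * H) ->
  exists sg : R, (sg = 1 \/ sg = -1) /\ forall u, Rbar_interval a b u ->
    lambda k P N u 0 * radius k P u = sg * angular k P u /\
    angular k P u ^ 2 = radius k P u ^ 2 + radius' k P u ^ 2 - delta k /\
    is_derive (fun s => lambda k P N s 0) u
      (2 * radius' k P u * (H - lambda k P N u 0) / radius k P u).
Proof.
  intros hM hN hW.
  set (C := profile_curve k P); set (T := Dvec C); set (A := Dvec T).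
  (* The orientation of the frame (C, C', N), later identified with the constant sign [sg]. *)
  set (sigma := fun u => vol k (C u) (T u) (N (u, 0))).
  assert (plane : forall u, profile_plane k (C u) /\ profile_plane k (T u)
    /\ profile_plane k (A u)).
  { intros u.
    assert (hC := profile_curve_plane k P); assert (hT := fun s => Dvec_plane k C s hC).
    repeat split; auto; now apply Dvec_plane. }
  assert (rpos : forall u, Rbar_interval a b u -> radius k P u <> 0).
  { intros u hu; assert (h := rs_radius _ _ _ _ hM u hu); lra. }
  assert (main : forall u, Rbar_interval a b u ->
    sigma u ^ 2 = 1 /\
    lambda k P N u 0 * radius k P u = sigma u * angular k P u /\
    angular k P u ^ 2 = radius k P u ^ 2 + radius' k P u ^ 2 - delta k /\
    sigma u * vol k (axis k) (C u) (A u) =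
      (2 * H - lambda k P N u 0) * radius' k P u).
  { intros u hu; destruct (plane u) as [pC [pT pA]].
    assert (gram : gt k (C u) (T u) = 0 /\ gt k (C u) (A u) = -1 /\ gt k (T u) (A u) = 0)
      by exact (profile_gram k 1 a b P u hM hu).
    destruct gram as [gCT [gCA gTA]].
    assert (gCC : gt k (C u) (C u) = 1) by exact (rs_de_Sitter _ _ _ _ hM u hu).
    assert (gTT : gt k (T u) (T u) = 1) by exact (rs_arclength _ _ _ _ hM u hu).
    assert (v0 := zero_in_v_range k).
    assert (gNC : gt k (N (u, 0)) (C u) = 0)
      by (unfold C; rewrite <- surf_0; apply (un_position _ _ _ _ _ hN); auto).
    assert (gNT : gt k (N (u, 0)) (T u) = 0)
      by (unfold T, C; rewrite <- r_u_0; apply (un_u _ _ _ _ _ hN); auto).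
    assert (gNv := un_v _ _ _ _ _ hN u 0 hu v0).
    assert (gNN := un_unit _ _ _ _ _ hN u 0 hu v0).
    assert (pN := normal_plane k P _ u (rpos u hu) gNv).
    assert (gAN : gt k (A u) (N (u, 0)) = - lambda k P N u 0 + 2 * H)
      by (unfold A, T, C; rewrite <- r_uu_0; apply hW; auto).
    assert (hr : gt k (axis k) (C u) = radius k P u) by apply gt_axis_profile.
    assert (gCN : gt k (C u) (N (u, 0)) = 0) by now rewrite gt_sym.
    assert (gTN : gt k (T u) (N (u, 0)) = 0) by now rewrite gt_sym.
    assert (gTC : gt k (T u) (C u) = 0) by now rewrite gt_sym.
    assert (gAC : gt k (A u) (C u) = -1) by now rewrite gt_sym.
    assert (gAT : gt k (A u) (T u) = 0) by now rewrite gt_sym.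
    assert (pn := axis_plane k).
    assert (l := lambda_0 k P N u (rpos u hu)).
    (* Pairing (C, C', N) with itself gives [sigma ^ 2 = 1]. Pairing it with (n, C, C') gives
       [sigma * D = - <n, N>], which is [lambda * f]; pairing it with (n, C, C'') gives
       [kappa * f']. *)
    assert (e1 := vol_mul_vol k _ _ _ _ _ _ pC pT pN pC pT pN).
    assert (e2 := vol_mul_vol k _ _ _ _ _ _ pn pC pT pC pT pN).
    assert (e3 := vol_mul_vol k _ _ _ _ _ _ pn pC pA pC pT pN).
    unfold det3 in *.
    rewrite ?gCC, ?gTT, ?gNN, ?gCT, ?gTC, ?gNC, ?gNT, ?gCN, ?gTN, ?gAC, ?gAT, ?gAN
      in e1.
    rewrite ?gCC, ?gTT, ?gNN, ?gCT, ?gTC, ?gNC, ?gNT, ?gCN, ?gTN, ?gAC, ?gAT, ?gAN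
      in e2.
    rewrite ?gCC, ?gTT, ?gNN, ?gCT, ?gTC, ?gNC, ?gNT, ?gCN, ?gTN, ?gAC, ?gAT, ?gAN
      in e3.
    fold (sigma u) in e1, e2, e3.
    change (gt k (axis k) (T u)) with (radius' k P u) in e3.
    change (vol k (axis k) (C u) (T u)) with (angular k P u) in e2.
    assert (s2 : sigma u ^ 2 = 1) by lra.
    assert (em : lambda k P N u 0 * radius k P u = - gt k (axis k) (N (u, 0)))
      by (rewrite l; field; auto).
    repeat split; auto; try lra.
    (* The Gram determinant of (n, C, C') yields [D ^ 2]; this is where [<n, n> = delta] enters. *)
    assert (e4 := vol_mul_vol k _ _ _ _ _ _ pn pC pT pn pC pT).
    unfold det3 in e4.
    rewrite (gt_sym k (C u) (axis k)), (gt_sym k (T u) (axis k)), gCC, gTT, gCT, gTC,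
      gt_axis_axis in e4.
    change (gt k (axis k) (T u)) with (radius' k P u) in e4.
    change (vol k (axis k) (C u) (T u)) with (angular k P u) in e4.
    rewrite hr in e4.
    simpl; lra. }
  (* [sigma] is continuous with square 1, so its sign, and hence its value, is constant. *)
  destruct (constant_sign a b sigma) as [sg [hsg spos]].
  { intros u hu; destruct (profile_is_derive _ _ _ _ _ hM hu) as [h1 h2]; split.
    - apply (continuity_pt_vol a b k N _ _ _ _ _ h1 h2 (un_continuous _ _ _ _ _ hN) hu).
    - intros e; destruct (main u hu) as [h _]; rewrite e in h; lra. }
  assert (sE : forall u, Rbar_interval a b u -> sigma u = sg).
  { intros u hu; destruct (main u hu) as [h _]; assert (p := spos u hu).
    assert (f : (sigma u - sg) * (sigma u + sg) = 0) by (destruct hsg as [-> | ->]; lra).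
    apply Rmult_integral in f; destruct f as [f|f]; [lra|].
    assert (sigma u = - sg) as e by lra; rewrite e in p; nra. }
  exists sg; split; auto; intros u hu.
  destruct (main u hu) as [_ [h1 [h2 h3]]]; rewrite (sE u hu) in h1, h3.
  split; [exact h1 | split; [exact h2 |]].
  (* [N] is only assumed continuous, so [lambda] is differentiated through its expression
     [sg * D / f]. *)
  assert (lamE : forall s, Rbar_interval a b s ->
    sg * angular k P s * / radius k P s = lambda k P N s 0).
  { intros s hs; destruct (main s hs) as [_ [e _]]; rewrite (sE s hs) in e.
    rewrite <- e; field; auto. }
  apply (is_derive_ext_loc (fun s => sg * angular k P s * / radius k P s)).
  { generalize (Rbar_interval_locally a b u hu); apply filter_imp; exact lamE. }
  evar_last.
  - apply is_derive_Rmult; [apply is_derive_Rmult|].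
    + apply is_derive_Rconst.
    + apply (angular_is_derive _ _ _ _ _ hM hu).
    + apply (is_derive_inv (radius k P) u _ (radius_is_derive _ _ _ _ _ hM hu)); auto.
  - rewrite Rmult_0_l, Rplus_0_l; fold C T A; rewrite h3, <- h1; field; auto.
Qed.

Lemma radius_first_integral (k : kind) (H : R) (a b : Rbar) (P : coords)
  (N : R * R -> E41) :
  rotational_surface k 1 (Rbar_interval a b) P ->
  unit_normal_field k 1 (Rbar_interval a b) P N ->
  (forall u v, Rbar_interval a b u -> v_range k v ->
     kappa k P N u v = - lambda k P N u v + 2 * H) ->
  (forall u, Rbar_interval a b u -> 0 < H - lambda k P N u 0) ->
  exists c, 0 < c /\ forall u, Rbar_interval a b u ->
    radius k P u ^ 2 * (2 * (H - lambda k P N u 0)) = c ^ 2.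
Proof.
  intros hM hN hW hpos.
  destruct (principal_curvature_equations k H a b P N hM hN hW) as [sg [_ eqs]].
  destruct (rotational_surface_inhabited _ _ _ _ hM) as [u0 hu0].
  (* The first integral. Its value at [u0] is positive, and [c] is the square root of that value. *)
  set (K := fun u => radius k P u * radius k P u * (2 * (H - lambda k P N u 0))).
  assert (rpos := rs_radius _ _ _ _ hM).
  assert (Kpos : 0 < K u0).
  { unfold K; assert (r := rpos u0 hu0); assert (h := hpos u0 hu0).
    apply Rmult_lt_0_compat; [apply Rmult_lt_0_compat|]; lra. }
  exists (sqrt (K u0)); split; [now apply sqrt_lt_R0|].
  intros u hu; rewrite pow2_sqrt by lra.
  transitivity (K u); [unfold K; ring|].
  apply (constant_of_derive a b); auto; intros z hz.
  destruct (eqs z hz) as [_ [_ dl]].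
  assert (dr := radius_is_derive _ _ _ _ _ hM hz).
  unfold K; evar_last.
  - apply is_derive_Rmult; [apply is_derive_Rmult; exact dr |].
    apply is_derive_Rmult; [apply is_derive_Rconst |].
    apply is_derive_Rminus; [apply is_derive_Rconst | exact dl].
  - cbv beta; field; assert (r := rpos z hz); lra.
Qed.

(** * The integrand of [Phi_1] and its pullback to the arc length parameter *)

Lemma Phi1_antiderivative (dl H c : R) (a b : Rbar) :
  (forall t, Rbar_interval a b t -> H - t > 0) ->
  (forall t, Rbar_interval a b t ->
     c ^ 2 - 2 * dl * (H - t) <> 0 /\ (t ^ 2 - 1) * c ^ 2 + 2 * dl * (H - t) > 0) ->
  exists F : R -> R, forall t, Rbar_interval a b t ->
    is_derive F t (Phi1_integrand dl H c t).
Proof.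
  intros hH hq.
  assert (cont : forall t, Rbar_interval a b t -> continuous (Phi1_integrand dl H c) t).
  { intros t ht; apply (ex_derive_continuous (Phi1_integrand dl H c)).
    assert (h := hH t ht); destruct (hq t ht) as [h1 h2].
    unfold Phi1_integrand; auto_derive.
    repeat split; try lra.
    assert (s1 := sqrt_lt_R0 _ h); assert (s2 := sqrt_lt_R0 _ h2).
    change (sqrt (H - t) * (c ^ 2 - 2 * dl * (H - t)) *
      sqrt ((t ^ 2 - 1) * c ^ 2 + 2 * dl * (H - t)) <> 0).
    repeat apply Rmult_integral_contrapositive_currified; auto; now apply Rgt_not_eq. }
  destruct (Classical_Prop.classic (exists t0, Rbar_interval a b t0)) as [[t0 ht0]|none].
  (* Integration starts at a point inside the interval, since the ends may be infinite or singular
     for the integrand. *)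
  - exists (RInt (Phi1_integrand dl H c) t0); intros t ht.
    apply (is_derive_RInt _ _ t0); [|now apply cont].
    generalize (Rbar_interval_locally a b t ht); apply filter_imp; intros s hs.
    apply (RInt_correct (Phi1_integrand dl H c)).
    apply (ex_RInt_continuous (Phi1_integrand dl H c)); intros z hz; apply cont.
    destruct (Rle_dec t0 s) as [h|h].
    + rewrite Rmin_left, Rmax_right in hz by lra.
      now apply (Rbar_interval_convex a b t0 s).
    + rewrite Rmin_right, Rmax_left in hz by lra.
      now apply (Rbar_interval_convex a b s t0).
  - exists (fun _ => 0); intros t ht; destruct none; eauto.
Qed.

Lemma sqrt_unique (x y : R) : 0 <= y -> y * y = x -> sqrt x = y.
Proof. intros hy <-; now apply sqrt_square. Qed.

(** The substitution [t = lambda] at one parameter value. Since [L ^ 2 * f ^ 2 = D ^ 2], the second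
    radicand is the square [c ^ 2 * f' ^ 2 / f ^ 2]; [nu] is the sign of [f'], so its root is
    [c * (nu * f') / f]. After cancellation [- sg * L * f / (f ^ 2 - dl)] remains. *)
Lemma Phi1_integrand_chain (dl H c L f f' D sg nu : R) :
  0 < c -> 0 < f -> f ^ 2 * (2 * (H - L)) = c ^ 2 -> L * f = sg * D ->
  (sg = 1 \/ sg = -1) -> D ^ 2 = f ^ 2 + f' ^ 2 - dl ->
  (nu = 1 \/ nu = -1) -> 0 < nu * f' -> f ^ 2 - dl <> 0 ->
  - nu * sg * (c ^ 2 / sqrt 2) * (2 * f' * (H - L) / f * Phi1_integrand dl H c L) =
  - D / (f ^ 2 - dl).
Proof.
  intros hc hf e1 e2 hsg e3 hnu hf' hd.
  assert (eH : H - L = c ^ 2 / (2 * f ^ 2)) by (rewrite <- e1; field; lra).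
  assert (eL : L = sg * D / f) by (rewrite <- e2; field; lra).
  assert (s2 : 0 < sqrt 2) by (apply sqrt_lt_R0; lra).
  assert (ss : sqrt 2 * sqrt 2 = 2) by (apply sqrt_sqrt; lra).
  assert (sg2 : sg * sg = 1) by (destruct hsg as [-> | ->]; ring).
  assert (nu2 : nu * nu = 1) by (destruct hnu as [-> | ->]; ring).
  assert (r1 : sqrt (H - L) = c / (sqrt 2 * f)).
  { apply sqrt_unique.
    - apply Rlt_le, Rdiv_lt_0_compat; auto; now apply Rmult_lt_0_compat.
    - rewrite eH.
      transitivity (c ^ 2 / (sqrt 2 * sqrt 2 * f ^ 2)); [field; lra|].
      rewrite ss; field; lra. }
  assert (r2 : sqrt ((L ^ 2 - 1) * c ^ 2 + 2 * dl * (H - L)) = c * (nu * f') / f).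
  { apply sqrt_unique.
    - apply Rlt_le, Rdiv_lt_0_compat; auto; now apply Rmult_lt_0_compat.
    - rewrite eH, eL.
      replace dl with (f ^ 2 + f' ^ 2 - D ^ 2) by lra.
      transitivity (c ^ 2 * (nu * nu) * f' ^ 2 / f ^ 2); [field; lra|].
      transitivity (((sg * sg * D ^ 2 / f ^ 2) - 1) * c ^ 2 +
        2 * (f ^ 2 + f' ^ 2 - D ^ 2) * (c ^ 2 / (2 * f ^ 2))); [|field; lra].
      rewrite sg2, nu2; field; lra. }
  unfold Phi1_integrand; rewrite r1, r2, eH.
  assert (f0 : f' <> 0) by (intros ->; lra).
  assert (n0 : nu <> 0) by (intros ->; lra).
  replace (c ^ 2 - 2 * dl * (c ^ 2 / (2 * f ^ 2)))
    with (c ^ 2 * (f ^ 2 - dl) / f ^ 2) by (field; lra).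
  transitivity (- (sg * (L * f)) / (f ^ 2 - dl)).
  - field; repeat split; auto; lra.
  - rewrite e2, <- Rmult_assoc, sg2; field; auto.
Qed.

Lemma profile_angle (k : kind) (H c : R) (a b a' b' : Rbar) (P : coords)
  (N : R * R -> E41) :
  rotational_surface k 1 (Rbar_interval a b) P ->
  unit_normal_field k 1 (Rbar_interval a b) P N ->
  (forall u v, Rbar_interval a b u -> v_range k v ->
     kappa k P N u v = - lambda k P N u v + 2 * H) ->
  (forall u, Rbar_interval a b u -> Rbar_interval a' b' (lambda k P N u 0)) ->
  (forall t, Rbar_interval a' b' t -> H - t > 0) ->
  0 < c ->
  (forall u, Rbar_interval a b u ->
     radius k P u ^ 2 * (2 * (H - lambda k P N u 0)) = c ^ 2) ->
  (forall t, Rbar_interval a' b' t ->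
     c ^ 2 - 2 * delta k * (H - t) <> 0 /\
     (t ^ 2 - 1) * c ^ 2 + 2 * delta k * (H - t) > 0) ->
  exists (s : R) (F : R -> R), (s = 1 \/ s = -1) /\
    (forall t, Rbar_interval a' b' t -> is_derive F t (Phi1_integrand (delta k) H c t)) /\
    (forall u, Rbar_interval a b u ->
       is_derive (fun u => s * (c ^ 2 / sqrt 2) * F (lambda k P N u 0)) u
         (- angular k P u / (radius k P u ^ 2 - delta k))).
Proof.
  intros hM hN hW hL hH hc hr hq.
  destruct (principal_curvature_equations k H a b P N hM hN hW) as [sg [hsg eqs]].
  destruct (Phi1_antiderivative (delta k) H c a' b' hH hq) as [F hF].
  assert (rpos := rs_radius _ _ _ _ hM).
  (* If [f'] vanished, [(lambda * f) ^ 2 = D ^ 2] would equal [f ^ 2 - delta], and the second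
     radicand of the integrand would be 0, against [hq]. *)
  destruct (constant_sign a b (radius' k P)) as [nu [hnu pnu]].
  { intros u hu; split; [now apply (continuity_pt_radius' _ _ _ _ _ hM)|]; intros e.
    destruct (eqs u hu) as [e1 [e2 _]]; destruct (hq _ (hL u hu)) as [_ h].
    assert (r := rpos u hu); assert (er := hr u hu).
    set (L := lambda k P N u 0) in *; set (f := radius k P u) in *.
    rewrite e in e2.
    assert (e3 : (L * f) ^ 2 = f ^ 2 - delta k)
      by (rewrite e1; destruct hsg as [-> | ->]; lra).
    rewrite <- er in h.
    replace ((L ^ 2 - 1) * (f ^ 2 * (2 * (H - L))) + 2 * delta k * (H - L))
      with (2 * (H - L) * ((L * f) ^ 2 - f ^ 2 + delta k)) in h by ring.
    rewrite e3 in h; lra. }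
  (* The sign before the integral combines the orientation of the frame with the direction in which
     the radius varies. *)
  exists (- nu * sg), F; split; [|split; auto].
  - destruct hnu as [-> | ->]; destruct hsg as [-> | ->]; lra.
  - intros u hu.
    destruct (eqs u hu) as [e1 [e2 dl]].
    assert (r := rpos u hu); assert (er := hr u hu); destruct (hq _ (hL u hu)) as [h _].
    assert (hd : radius k P u ^ 2 - delta k <> 0).
    { intros e; apply h; replace (delta k) with (radius k P u ^ 2) by lra.
      rewrite <- er; ring. }
    rewrite <- (Phi1_integrand_chain _ H c _ _ _ _ sg nu hc r er e1 hsg e2 hnu (pnu u hu) hd).
    evar_last.
    + apply is_derive_Rmult; [apply is_derive_Rconst|].
      apply (is_derive_Rcomp F (fun s => lambda k P N s 0)); [|exact dl].
      apply hF; auto.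
    + cbv beta; ring.
Qed.

(** * Polar angles on circles and hyperbolas *)

Lemma circle_angle_exists (x y : R) :
  x ^ 2 + y ^ 2 = 1 -> exists al, cos al = x /\ sin al = y.
Proof.
  intros e; assert (hx : -1 <= x <= 1) by nra.
  destruct (Rle_dec 0 y) as [h|h].
  - exists (acos x); rewrite cos_acos, sin_acos by auto; split; auto.
    apply sqrt_unique; unfold Rsqr; lra.
  - exists (- acos x); rewrite cos_neg, sin_neg, cos_acos, sin_acos by auto; split; auto.
    rewrite (sqrt_unique _ (- y)); unfold Rsqr; lra.
Qed.

(** Turning [(x, y) / r] back by the angle [Phi] gives a vector [(E1, E2)] with derivative 0. The
    constant in [Phi] makes this vector [(1, 0)] at [u0]; turning forward again gives the claim. *)
Lemma circle_angle (a b : Rbar) (x y x' y' g : R -> R) (u0 : R) :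
  Rbar_interval a b u0 ->
  (forall u, Rbar_interval a b u ->
     0 < x u ^ 2 + y u ^ 2 /\ is_derive x u (x' u) /\ is_derive y u (y' u) /\
     is_derive g u ((x u * y' u - y u * x' u) / (x u ^ 2 + y u ^ 2))) ->
  exists phi0, forall u, Rbar_interval a b u ->
    x u = sqrt (x u ^ 2 + y u ^ 2) * cos (phi0 + g u) /\
    y u = sqrt (x u ^ 2 + y u ^ 2) * sin (phi0 + g u).
Proof.
  intros hu0 h.
  set (r := fun u => sqrt (x u ^ 2 + y u ^ 2)).
  assert (rpos : forall u, Rbar_interval a b u -> 0 < r u).
  { intros u hu; apply sqrt_lt_R0, h, hu. }
  assert (r2 : forall u, Rbar_interval a b u -> x u ^ 2 + y u ^ 2 = r u ^ 2).
  { intros u hu; unfold r; rewrite pow2_sqrt; auto; apply Rlt_le, h, hu. }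
  destruct (circle_angle_exists (x u0 / r u0) (y u0 / r u0)) as [al [eC eS]].
  { assert (p := rpos u0 hu0).
    transitivity ((x u0 ^ 2 + y u0 ^ 2) / r u0 ^ 2); [field; lra|].
    rewrite r2 by auto; field; lra. }
  exists (al - g u0).
  set (Phi := fun u => al - g u0 + g u).
  set (E1 := fun u => (x u * cos (Phi u) + y u * sin (Phi u)) / r u).
  set (E2 := fun u => (y u * cos (Phi u) - x u * sin (Phi u)) / r u).
  assert (der : forall u, Rbar_interval a b u -> is_derive E1 u 0 /\ is_derive E2 u 0).
  { intros u hu; destruct (h u hu) as [hr [dx [dy dg]]].
    assert (p := rpos u hu); assert (e := r2 u hu).
    (* The velocity is split into a radial part, through [W], and an angular part, through [G]; once
       these are opaque, the terms in the derivatives of [E1] and [E2] cancel by [field]. *)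
    set (G := (x u * y' u - y u * x' u) / (x u ^ 2 + y u ^ 2)) in *.
    set (W := x u * x' u + y u * y' u).
    assert (ex : x' u = x u * W / r u ^ 2 - y u * G)
      by (unfold W, G; rewrite <- e; field; lra).
    assert (ey : y' u = y u * W / r u ^ 2 + x u * G)
      by (unfold W, G; rewrite <- e; field; lra).
    assert (dr : is_derive r u (W / r u)).
    { evar_last.
      - apply (is_derive_sqrt (fun s => x s ^ 2 + y s ^ 2)); auto.
        apply is_derive_Rplus; apply is_derive_pow; [exact dx | exact dy].
      - fold (r u); unfold W; simpl; field; lra. }
    assert (dphi : is_derive Phi u (0 + G)).
    { apply is_derive_Rplus; [apply is_derive_Rconst | exact dg]. }
    assert (dc := is_derive_Rcomp cos Phi u _ _ (is_derive_cos (Phi u)) dphi).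
    assert (ds := is_derive_Rcomp sin Phi u _ _ (is_derive_sin (Phi u)) dphi).
    assert (di := is_derive_inv r u _ dr (Rgt_not_eq _ _ p)).
    generalize dependent W; generalize dependent G; intros.
    split; (evar_last;
      [ apply is_derive_Rmult; [derive_arith | exact di]
      | cbv beta; rewrite ex, ey; field; lra ]). }
  assert (c1 : forall u, Rbar_interval a b u -> E1 u = 1 /\ E2 u = 0).
  { intros u hu.
    rewrite (constant_of_derive a b E1 u u0), (constant_of_derive a b E2 u u0)
      by (auto; intros; now apply der).
    assert (p := rpos u0 hu0).
    unfold E1, E2, Phi; replace (al - g u0 + g u0) with al by ring; rewrite eC, eS.
    split; [|field; lra].
    transitivity ((x u0 ^ 2 + y u0 ^ 2) / r u0 ^ 2); [field; lra|].
    rewrite r2 by auto; field; lra. }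
  intros u hu; destruct (c1 u hu) as [e1 e2]; assert (p := rpos u hu).
  fold (r u) (Phi u); assert (cs := sin2_cos2 (Phi u)); unfold Rsqr in cs.
  unfold E1, E2 in e1, e2.
  split.
  - transitivity (r u * ((x u * cos (Phi u) + y u * sin (Phi u)) / r u * cos (Phi u)
      - (y u * cos (Phi u) - x u * sin (Phi u)) / r u * sin (Phi u))).
    + transitivity (x u * (sin (Phi u) * sin (Phi u) + cos (Phi u) * cos (Phi u)));
        [rewrite cs; ring | field; lra].
    + rewrite e1, e2; ring.
  - transitivity (r u * ((x u * cos (Phi u) + y u * sin (Phi u)) / r u * sin (Phi u)
      + (y u * cos (Phi u) - x u * sin (Phi u)) / r u * cos (Phi u))).
    + transitivity (y u * (sin (Phi u) * sin (Phi u) + cos (Phi u) * cos (Phi u)));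
        [rewrite cs; ring | field; lra].
    + rewrite e1, e2; ring.
Qed.

Lemma cosh_sqr_minus_sinh_sqr (z : R) : cosh z * cosh z - sinh z * sinh z = 1.
Proof.
  unfold cosh, sinh; rewrite exp_Ropp; field; assert (h := exp_pos z); lra.
Qed.

(** [sg] selects the branch of the hyperbola, which no choice of [al] can change; within a branch
    the parameter is an [arcsinh]. *)
Lemma hyperbola_angle_exists (x y : R) :
  x ^ 2 - y ^ 2 = 1 ->
  exists sg al, (sg = 1 \/ sg = -1) /\ x = sg * cosh al /\ y = sg * sinh al.
Proof.
  intros e.
  assert (hs : exists sg, (sg = 1 \/ sg = -1) /\ 0 < sg * x).
  { destruct (Rtotal_order 0 x) as [h|[h|h]];
      [exists 1 | rewrite <- h in e; exfalso; nra | exists (-1)]; split; auto; lra. }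
  destruct hs as [sg [hsg px]].
  assert (sg2 : sg * sg = 1) by (destruct hsg as [-> | ->]; ring).
  exists sg, (arcsinh (sg * y)).
  assert (cp : 0 < cosh (arcsinh (sg * y))).
  { unfold cosh; assert (p := exp_pos (arcsinh (sg * y)));
      assert (q := exp_pos (- arcsinh (sg * y))); lra. }
  assert (ch : cosh (arcsinh (sg * y)) * cosh (arcsinh (sg * y)) = 1 + (sg * y) * (sg * y)).
  { rewrite <- (sinh_arcsinh (sg * y)) at 3 4.
    generalize (arcsinh (sg * y)); intros z; assert (h := cosh_sqr_minus_sinh_sqr z).
    lra. }
  rewrite sinh_arcsinh; split; [auto | split].
  - assert (f : (sg * x - cosh (arcsinh (sg * y))) * (sg * x + cosh (arcsinh (sg * y))) = 0).
    { replace ((sg * x - cosh (arcsinh (sg * y))) * (sg * x + cosh (arcsinh (sg * y))))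
        with (sg * sg * x ^ 2 - cosh (arcsinh (sg * y)) * cosh (arcsinh (sg * y))) by ring.
      rewrite ch.
      replace (1 + sg * y * (sg * y)) with (1 + sg * sg * y ^ 2) by ring.
      rewrite sg2; lra. }
    apply Rmult_integral in f; destruct f as [f|f]; [|lra].
    replace (cosh (arcsinh (sg * y))) with (sg * x) by lra.
    rewrite <- Rmult_assoc, sg2; ring.
  - rewrite <- Rmult_assoc, sg2; ring.
Qed.

(** The argument of [circle_angle] with Lorentz boosts in place of rotations. The boosted vector is
    constant and equals [(sg, 0)] at [u0], so one branch sign serves the whole interval. *)
Lemma hyperbola_angle (a b : Rbar) (x y x' y' g : R -> R) (u0 : R) :
  Rbar_interval a b u0 ->
  (forall u, Rbar_interval a b u ->
     0 < x u ^ 2 - y u ^ 2 /\ is_derive x u (x' u) /\ is_derive y u (y' u) /\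
     is_derive g u ((x u * y' u - y u * x' u) / (x u ^ 2 - y u ^ 2))) ->
  exists phi0 sg, (sg = 1 \/ sg = -1) /\ forall u, Rbar_interval a b u ->
    x u = sg * (sqrt (x u ^ 2 - y u ^ 2) * cosh (phi0 + g u)) /\
    y u = sg * (sqrt (x u ^ 2 - y u ^ 2) * sinh (phi0 + g u)).
Proof.
  intros hu0 h.
  set (r := fun u => sqrt (x u ^ 2 - y u ^ 2)).
  assert (rpos : forall u, Rbar_interval a b u -> 0 < r u).
  { intros u hu; apply sqrt_lt_R0, h, hu. }
  assert (r2 : forall u, Rbar_interval a b u -> x u ^ 2 - y u ^ 2 = r u ^ 2).
  { intros u hu; unfold r; rewrite pow2_sqrt; auto; apply Rlt_le, h, hu. }
  destruct (hyperbola_angle_exists (x u0 / r u0) (y u0 / r u0))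
    as [sg [al [hsg [eC eS]]]].
  { assert (p := rpos u0 hu0).
    transitivity ((x u0 ^ 2 - y u0 ^ 2) / r u0 ^ 2); [field; lra|].
    rewrite r2 by auto; field; lra. }
  exists (al - g u0), sg; split; auto.
  set (Phi := fun u => al - g u0 + g u).
  set (E1 := fun u => (x u * cosh (Phi u) - y u * sinh (Phi u)) / r u).
  set (E2 := fun u => (y u * cosh (Phi u) - x u * sinh (Phi u)) / r u).
  assert (der : forall u, Rbar_interval a b u -> is_derive E1 u 0 /\ is_derive E2 u 0).
  { intros u hu; destruct (h u hu) as [hr [dx [dy dg]]].
    assert (p := rpos u hu); assert (e := r2 u hu).
    set (G := (x u * y' u - y u * x' u) / (x u ^ 2 - y u ^ 2)) in *.
    set (W := x u * x' u - y u * y' u).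
    assert (ex : x' u = x u * W / r u ^ 2 + y u * G)
      by (unfold W, G; rewrite <- e; field; lra).
    assert (ey : y' u = y u * W / r u ^ 2 + x u * G)
      by (unfold W, G; rewrite <- e; field; lra).
    assert (dr : is_derive r u (W / r u)).
    { evar_last.
      - apply (is_derive_sqrt (fun s => x s ^ 2 - y s ^ 2)); auto.
        apply is_derive_Rminus; apply is_derive_pow; [exact dx | exact dy].
      - fold (r u); unfold W; simpl; field; lra. }
    assert (dphi : is_derive Phi u (0 + G)).
    { apply is_derive_Rplus; [apply is_derive_Rconst | exact dg]. }
    assert (dc := is_derive_Rcomp cosh Phi u _ _
      (proj2 (is_derive_Reals _ _ _) (derivable_pt_lim_cosh (Phi u))) dphi).
    assert (ds := is_derive_Rcomp sinh Phi u _ _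
      (proj2 (is_derive_Reals _ _ _) (derivable_pt_lim_sinh (Phi u))) dphi).
    assert (di := is_derive_inv r u _ dr (Rgt_not_eq _ _ p)).
    generalize dependent W; generalize dependent G; intros.
    split; (evar_last;
      [ apply is_derive_Rmult; [derive_arith | exact di]
      | cbv beta; rewrite ex, ey; field; lra ]). }
  assert (c1 : forall u, Rbar_interval a b u -> E1 u = sg /\ E2 u = 0).
  { intros u hu.
    rewrite (constant_of_derive a b E1 u u0), (constant_of_derive a b E2 u u0)
      by (auto; intros; now apply der).
    assert (p := rpos u0 hu0).
    unfold E1, E2, Phi; replace (al - g u0 + g u0) with al by ring.
    split.
    - transitivity (x u0 / r u0 * cosh al - y u0 / r u0 * sinh al); [field; lra|].
      rewrite eC, eS.
      transitivity (sg * (cosh al * cosh al - sinh al * sinh al)); [ring|].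
      rewrite cosh_sqr_minus_sinh_sqr; ring.
    - transitivity (y u0 / r u0 * cosh al - x u0 / r u0 * sinh al); [field; lra|].
      rewrite eC, eS; ring. }
  intros u hu; destruct (c1 u hu) as [e1 e2]; assert (p := rpos u hu).
  fold (r u) (Phi u); assert (cs' := cosh_sqr_minus_sinh_sqr (Phi u)).
  unfold E1, E2 in e1, e2.
  split.
  - transitivity (r u * ((x u * cosh (Phi u) - y u * sinh (Phi u)) / r u * cosh (Phi u)
      + (y u * cosh (Phi u) - x u * sinh (Phi u)) / r u * sinh (Phi u))).
    + transitivity (x u * (cosh (Phi u) * cosh (Phi u) - sinh (Phi u) * sinh (Phi u)));
        [rewrite cs'; ring | field; lra].
    + rewrite e1, e2; ring.
  - transitivity (r u * ((x u * cosh (Phi u) - y u * sinh (Phi u)) / r u * sinh (Phi u)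
      + (y u * cosh (Phi u) - x u * sinh (Phi u)) / r u * cosh (Phi u))).
    + transitivity (y u * (cosh (Phi u) * cosh (Phi u) - sinh (Phi u) * sinh (Phi u)));
        [rewrite cs'; ring | field; lra].
    + rewrite e1, e2; ring.
Qed.

(** * Admissible ranges of [lambda] *)

Lemma interval_avoids_roots (a b : Rbar) (p m D : R) :
  0 < p -> 0 <= D ->
  (forall t, Rbar_interval a b t -> D < (p * t - m) ^ 2) ->
  (forall t, Rbar_interval a b t -> t < (m - sqrt D) / p) \/
  (forall t, Rbar_interval a b t -> (m + sqrt D) / p < t).
Proof.
  intros hp hD h.
  assert (S2 := sqrt_sqrt D hD); assert (S0 := sqrt_pos D).
  assert (out : forall t, Rbar_interval a b t ->
    p * t < m - sqrt D \/ m + sqrt D < p * t).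
  { intros t ht; assert (q := h t ht).
    destruct (Rlt_le_dec (p * t) (m - sqrt D)); auto.
    destruct (Rlt_le_dec (m + sqrt D) (p * t)); auto; exfalso; nra. }
  assert (toL : forall t, p * t < m - sqrt D -> t < (m - sqrt D) / p).
  { intros t ht; apply Rmult_lt_reg_l with p; auto; field_simplify; lra. }
  assert (toR : forall t, m + sqrt D < p * t -> (m + sqrt D) / p < t).
  { intros t ht; apply Rmult_lt_reg_l with p; auto; field_simplify; lra. }
  destruct (Classical_Prop.classic (exists t, Rbar_interval a b t /\ p * t < m - sqrt D))
    as [[t1 [h1 l1]]|none].
  - left; intros t2 h2; destruct (out t2 h2) as [l2|l2]; auto; exfalso.
    (* Points on both sides would put the midpoint [m / p] of the roots into the interval, where the
       square is 0 and cannot exceed [D]. *)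
    assert (hz : Rbar_interval a b (m / p)).
    { apply (Rbar_interval_convex a b t1 t2); auto; split;
        apply Rmult_le_reg_l with p; auto; field_simplify; lra. }
    assert (q := h _ hz); replace (p * (m / p) - m) with 0 in q by (field; lra); lra.
  - right; intros t ht; apply toR; destruct (out t ht); auto; destruct none; eauto.
Qed.

(** The left side comes from completing the square: [c ^ 2] times the second radicand is
    [(c ^ 2 * t - 1) ^ 2] minus it. Real roots thus exist exactly when [H <= Hcrit c]. *)
Lemma spherical_discriminant (c H : R) :
  0 < c -> 1 - 2 * H * c ^ 2 + c ^ 4 = 2 * c ^ 2 * (Hcrit c - H).
Proof. intros hc; unfold Hcrit; field; lra. Qed.

(** Here the completed square is [(c ^ 2 * t + 1) ^ 2], and real roots exist exactly when
    [- Hcrit c <= H]. *)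
Lemma hyperbolic_discriminant (c H : R) :
  0 < c -> 1 + 2 * H * c ^ 2 + c ^ 4 = 2 * c ^ 2 * (Hcrit c + H).
Proof. intros hc; unfold Hcrit; field; lra. Qed.

(** Below [Hcrit c] the interval lies wholly to one side of the two roots. The left side gives the
    second range; the right side is sorted further by [H] and [c]. *)
Lemma sphere_outside_cases (a b : Rbar) (H c t0 : R) :
  0 < c -> Rbar_interval a b t0 ->
  (forall t, Rbar_interval a b t -> H - c ^ 2 / 2 < t < H) ->
  (forall t, Rbar_interval a b t -> 0 < (t ^ 2 - 1) * c ^ 2 + 2 * (H - t)) ->
  ((Hcrit c <= H \/ (1 <= H < Hcrit c /\ c < 1) \/ H <= -1) /\
     forall t, Rbar_interval a b t -> H - c ^ 2 / 2 < t < H)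
  \/ ((H < c ^ 2 / 2 \/ c ^ 2 / 2 < H < Hcrit c) /\
      forall t, Rbar_interval a b t ->
        H - c ^ 2 / 2 < t < (1 - sqrt (1 - 2 * H * c ^ 2 + c ^ 4)) / c ^ 2)
  \/ ((1 < H < Hcrit c /\ 1 < c) /\
      forall t, Rbar_interval a b t ->
        (1 + sqrt (1 - 2 * H * c ^ 2 + c ^ 4)) / c ^ 2 < t < H).
Proof.
  intros hc h0 hb hq.
  destruct (Rle_lt_dec (Hcrit c) H) as [hH|hH]; [left; auto|].
  assert (c2 : 0 < c ^ 2) by (apply pow_lt; auto).
  assert (eD := spherical_discriminant c H hc).
  assert (D0 : 0 <= 1 - 2 * H * c ^ 2 + c ^ 4) by (rewrite eD; nra).
  assert (S0 := sqrt_pos (1 - 2 * H * c ^ 2 + c ^ 4)).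
  assert (S2 := sqrt_sqrt _ D0).
  destruct (interval_avoids_roots a b (c ^ 2) 1 (1 - 2 * H * c ^ 2 + c ^ 4) c2 D0)
    as [hl|hr].
  { intros t ht; assert (q := hq t ht).
    assert (0 < c ^ 2 * ((t ^ 2 - 1) * c ^ 2 + 2 * (H - t)))
      by now apply Rmult_lt_0_compat.
    nra. }
  - right; left; split.
    (* At [H = c ^ 2 / 2] the discriminant is 1 and the smaller root is 0, which is also
       [H - c ^ 2 / 2]: no room is left for [t0]. *)
    + destruct (Rtotal_order H (c ^ 2 / 2)) as [h|[h|h]]; auto; exfalso.
      assert (l := hl t0 h0); assert (q := hb t0 h0).
      replace (1 - 2 * H * c ^ 2 + c ^ 4) with (1 * 1) in l by (rewrite h; field).
      rewrite sqrt_square in l by lra.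
      replace ((1 - 1) / c ^ 2) with 0 in l by (field; lra); lra.
    + intros t ht; split; [apply hb | apply hl]; auto.
  (* The point [t0] lies between the larger root and [H]. *)
  - assert (lt : 1 + sqrt (1 - 2 * H * c ^ 2 + c ^ 4) < c ^ 2 * H).
    { assert (l := hr t0 h0); assert (q := hb t0 h0).
      apply (Rmult_lt_compat_l (c ^ 2)) in l; auto.
      replace (c ^ 2 * ((1 + sqrt (1 - 2 * H * c ^ 2 + c ^ 4)) / c ^ 2))
        with (1 + sqrt (1 - 2 * H * c ^ 2 + c ^ 4)) in l by (field; lra).
      nra. }
    (* (c^2 H - 1)^2 exceeds the discriminant by c^4 (H^2 - 1) *)
    assert (H2 : 1 < H ^ 2).
    { assert (0 < c ^ 4 * (H ^ 2 - 1)).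
      { replace (c ^ 4 * (H ^ 2 - 1)) with
          ((c ^ 2 * H - 1) ^ 2 - (1 - 2 * H * c ^ 2 + c ^ 4)) by ring; nra. }
      assert (c4 : 0 < c ^ 4) by (apply pow_lt; auto); nra. }
    destruct (Rle_lt_dec H (-1)) as [h|h]; [left; auto|].
    assert (h1 : 1 < H) by nra.
    destruct (Rtotal_order c 1) as [h'|[h'|h']].
    + left; split; auto; right; left; repeat split; auto; lra.
    (* For [c = 1] the critical value is 1, while [1 < H < Hcrit c]. *)
    + exfalso; rewrite h' in hH; unfold Hcrit in hH; lra.
    + right; right; split; [auto|].
      intros t ht; split; [apply hr | apply hb]; auto.
Qed.

Lemma hyperbolic_cases (a b : Rbar) (H c t0 : R) :
  0 < c -> Rbar_interval a b t0 ->
  (forall t, Rbar_interval a b t -> t < H) ->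
  (forall t, Rbar_interval a b t -> 0 < (t ^ 2 - 1) * c ^ 2 - 2 * (H - t)) ->
  hyperbolic_ranges (Rbar_interval a b) H c \/
  hyperbolic_other_ranges (Rbar_interval a b) H c.
Proof.
  intros hc h0 hb hq; unfold hyperbolic_ranges, hyperbolic_other_ranges.
  assert (c2 : 0 < c ^ 2) by (apply pow_lt; auto).
  assert (crit1 : c = 1 -> Hcrit c = 1) by (intros ->; unfold Hcrit; field).
  assert (inv1 : c = 1 -> 1 / c ^ 2 = 1) by (intros ->; field).
  assert (inv_lt : 1 < c -> 1 / c ^ 2 < 1).
  { intros h; apply Rmult_lt_reg_l with (c ^ 2); auto.
    replace (c ^ 2 * (1 / c ^ 2)) with 1 by (field; lra); nra. }
  (* [Hcrit c] is the mean of [c ^ 2] and [1 / c ^ 2], and for [1 < c] the latter is the smaller. *)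
  assert (crit_ge : 1 < c -> 1 / c ^ 2 <= Hcrit c).
  { intros h; assert (i := inv_lt h); unfold Hcrit; nra. }
  assert (eD := hyperbolic_discriminant c H hc).
  destruct (Rle_lt_dec H (- Hcrit c)) as [hH|hH].
  { destruct (Rtotal_order c 1) as [h|[h|h]].
    - right; left; auto.
    - destruct (Req_dec H (-1)) as [e|e].
      (* With [H = -1] and [c = 1] the discriminant is 0 and the double root -1 equals [H], so the
         second range reads [t < H]. *)
      + left; right; left; rewrite inv1 by auto; split; [lra|].
        replace (1 + 2 * H * c ^ 2 + c ^ 4) with 0 by (rewrite h, e; ring).
        rewrite sqrt_0, h, e in *; intros t ht; assert (l := hb t ht).
        replace ((-1 - 0) / 1 ^ 2) with (-1) by field; auto.
      + right; left; rewrite crit1 in hH by auto; split; auto; right; split; auto; lra.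
    - left; left; split; auto; split; auto; assert (i := crit_ge h); lra. }
  assert (D0 : 0 <= 1 + 2 * H * c ^ 2 + c ^ 4) by (rewrite eD; nra).
  assert (S0 := sqrt_pos (1 + 2 * H * c ^ 2 + c ^ 4)).
  assert (S2 := sqrt_sqrt _ D0).
  destruct (interval_avoids_roots a b (c ^ 2) (-1) (1 + 2 * H * c ^ 2 + c ^ 4) c2 D0)
    as [hl|hr].
  { intros t ht; assert (q := hq t ht).
    assert (0 < c ^ 2 * ((t ^ 2 - 1) * c ^ 2 - 2 * (H - t)))
      by now apply Rmult_lt_0_compat.
    nra. }
  - destruct (Rlt_le_dec c 1) as [h|h]; [right; right; left; auto|].
    destruct (Rlt_le_dec (- (1 / c ^ 2)) H) as [h'|h']; [right; right; left; auto|].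
    (* For [1 < c] and [H <= - (1 / c ^ 2)] the first range applies, through [t < H]; for [c = 1]
       this bound on [H] contradicts [- Hcrit c < H]. *)
    destruct (Rle_lt_or_eq_dec _ _ h) as [h1|h1]; [left; left; auto|].
    exfalso; rewrite crit1 in hH by auto; rewrite inv1 in h' by auto; lra.
  - assert (lt : -1 + sqrt (1 + 2 * H * c ^ 2 + c ^ 4) < c ^ 2 * H).
    { assert (l := hr t0 h0); assert (q := hb t0 h0).
      apply (Rmult_lt_compat_l (c ^ 2)) in l; auto.
      replace (c ^ 2 * ((-1 + sqrt (1 + 2 * H * c ^ 2 + c ^ 4)) / c ^ 2))
        with (-1 + sqrt (1 + 2 * H * c ^ 2 + c ^ 4)) in l by (field; lra).
      nra. }
    (* (c^2 H + 1)^2 exceeds the discriminant by c^4 (H^2 - 1) *)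
    assert (H2 : 1 < H ^ 2).
    { assert (0 < c ^ 4 * (H ^ 2 - 1)).
      { replace (c ^ 4 * (H ^ 2 - 1)) with
          ((c ^ 2 * H + 1) ^ 2 - (1 + 2 * H * c ^ 2 + c ^ 4)) by ring; nra. }
      assert (c4 : 0 < c ^ 4) by (apply pow_lt; auto); nra. }
    assert (hr' : forall t, Rbar_interval a b t ->
      (-1 + sqrt (1 + 2 * H * c ^ 2 + c ^ 4)) / c ^ 2 < t < H) by (split; auto).
    destruct (Rle_lt_dec H (-1)) as [h|h].
    + destruct (Rtotal_order c 1) as [h1|[h1|h1]].
      * left; right; right; auto.
      * exfalso; rewrite crit1 in hH by auto; lra.
      (* Here [H <= -1 < - (1 / c ^ 2)], so the first range applies again. *)
      * left; left; split; auto; split; auto; assert (i := inv_lt h1); lra.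
    + assert (h1 : 1 < H) by nra.
      destruct (Rle_lt_dec c 1) as [h'|h'].
      * right; right; right; auto.
      * left; right; right; split; auto; right; lra.
Qed.

Lemma parabolic_cases (a b : Rbar) (H c : R) :
  (forall t, Rbar_interval a b t -> t < H) ->
  (forall t, Rbar_interval a b t -> 0 < (t ^ 2 - 1) * c ^ 2) ->
  (H < -1 /\ forall t, Rbar_interval a b t -> t < H)
  \/ (-1 <= H <= 1 /\ forall t, Rbar_interval a b t -> t < -1)
  \/ (1 < H /\ forall t, Rbar_interval a b t -> t < -1 \/ 1 < t < H).
Proof.
  intros hb hq.
  assert (out : forall t, Rbar_interval a b t -> t < -1 \/ 1 < t).
  { intros t ht; assert (q := hq t ht); assert (c2 := pow2_ge_0 c).
    destruct (Rlt_le_dec t (-1)) as [h1|h1]; auto.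
    destruct (Rlt_le_dec 1 t) as [h2|h2]; auto; exfalso.
    assert (0 <= (1 - t ^ 2) * c ^ 2) by (apply Rmult_le_pos; nra); lra. }
  destruct (Rlt_le_dec H (-1)) as [h|h]; auto.
  destruct (Rle_lt_dec H 1) as [h'|h']; right; [left | right]; split; auto;
    intros t ht; assert (l := hb t ht); destruct (out t ht); auto; lra.
Qed.

(** * Explicit coordinates and the classification *)

Lemma radius_formula_eq (H c f t : R) :
  0 < c -> 0 < f -> f ^ 2 * (2 * (H - t)) = c ^ 2 -> f = radius_formula H c t.
Proof.
  intros hc hf e; unfold radius_formula.
  rewrite (sqrt_unique (2 * (H - t)) (c / f)).
  - field; lra.
  - apply Rlt_le, Rdiv_lt_0_compat; auto.
  - transitivity (c ^ 2 / f ^ 2); [field; lra|]; rewrite <- e; field; lra.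
Qed.

(** The form in which [D] meets the polar angles: up to sign it is the numerator of the derivative
    of the angle, or of [x / z] when [delta = 0]. *)
Lemma angular_eq (k : kind) (P : coords) (u : R) :
  angular k P u =
  match k with
  | spherical => cz P u * Derive (cw P) u - cw P u * Derive (cz P) u
  | hyperbolic => cy P u * Derive (cx P) u - cx P u * Derive (cy P) u
  | parabolic => cx P u * Derive (cz P) u - cz P u * Derive (cx P) u
  end.
Proof.
  destruct k.
  - change (det3 1 0 0 (cy P u) (cz P u) (cw P u)
      (Derive (cy P) u) (Derive (cz P) u) (Derive (cw P) u) =
      cz P u * Derive (cw P) u - cw P u * Derive (cz P) u); unfold det3; ring.
  - change (det3 0 0 (-1) (cx P u) (cy P u) (cw P u)
      (Derive (cx P) u) (Derive (cy P) u) (Derive (cw P) u) =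
      cy P u * Derive (cx P) u - cx P u * Derive (cy P) u); unfold det3; ring.
  - change (det3 0 0 1 (cx P u) (cz P u) (cw P u)
      (Derive (cx P) u) (Derive (cz P) u) (Derive (cw P) u) =
      cx P u * Derive (cz P) u - cz P u * Derive (cx P) u); unfold det3; ring.
Qed.

Lemma profile_de_Sitter (k : kind) (P : coords) (u : R) :
  de_Sitter k (profile_curve k P u) ->
  match k with
  | spherical => cy P u ^ 2 + cz P u ^ 2 - cw P u ^ 2 = 1
  | hyperbolic => cx P u ^ 2 + cy P u ^ 2 - cw P u ^ 2 = 1
  | parabolic => cx P u ^ 2 + 2 * cz P u * cw P u = 1
  end.
Proof.
  destruct k; unfold de_Sitter, gt, x1, x2, x3, x4; simpl; lra.
Qed.

Lemma profile_coordinates_derive (k : kind) (eps : R) (J : R -> Prop) (P : coords) (u : R) :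
  rotational_surface k eps J P -> J u ->
  match k with
  | spherical =>
      is_derive (cz P) u (Derive (cz P) u) /\ is_derive (cw P) u (Derive (cw P) u)
  | hyperbolic =>
      is_derive (cx P) u (Derive (cx P) u) /\ is_derive (cy P) u (Derive (cy P) u)
  | parabolic =>
      is_derive (cx P) u (Derive (cx P) u) /\ is_derive (cz P) u (Derive (cz P) u)
  end.
Proof.
  intros hM hu; destruct (profile_is_derive _ _ _ _ _ hM hu) as [[[d1 d2] [d3 d4]] _].
  destruct k; split; [exact d3 | exact d4 | exact d1 | exact d2 | exact d1 | exact d3].
Qed.

(** The last assumption involves [c], which the surface determines through the first integral; it
    therefore stands under the existential quantifier. *)
Theorem corollary3p2 (k : kind) (H : R) (aJ bJ aI bI : Rbar)
  (P : coords) (N : R * R -> E41) (U : R -> R)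
  (hM : rotational_surface k 1 (Rbar_interval aJ bJ) P)
  (hN : unit_normal_field k 1 (Rbar_interval aJ bJ) P N)
  (hW : forall u v, Rbar_interval aJ bJ u -> v_range k v ->
          kappa k P N u v = - lambda k P N u v + 2 * H)
  (hU : lambda_parameter k (Rbar_interval aJ bJ) (Rbar_interval aI bI) P N U)
  (hH : forall t, Rbar_interval aI bI t -> H - t > 0) :
  exists c : R, 0 < c /\
    (forall t, Rbar_interval aI bI t ->
       radius k (reparam P U) t = radius_formula H c t) /\
    ((forall t, Rbar_interval aI bI t ->
        c ^ 2 - 2 * delta k * (H - t) <> 0 /\
        (t ^ 2 - 1) * c ^ 2 + 2 * delta k * (H - t) > 0) ->
     profile_cases k (Rbar_interval aI bI) H c (reparam P U)).
Proof.
  assert (v0 := zero_in_v_range k).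
  destruct hU as [hUJ [hUl hl]].
  assert (hL : forall u, Rbar_interval aJ bJ u -> Rbar_interval aI bI (lambda k P N u 0))
    by (intros u hu; now apply hl).
  assert (lU : forall t, Rbar_interval aI bI t -> lambda k P N (U t) 0 = t) by auto.
  destruct (radius_first_integral k H aJ bJ P N hM hN hW) as [c [hc hr]].
  { intros u hu; now apply hH, hL. }
  destruct (rotational_surface_inhabited _ _ _ _ hM) as [u0 hu0].
  assert (rpos := rs_radius _ _ _ _ hM).
  assert (hrU : forall t, Rbar_interval aI bI t ->
    radius k P (U t) ^ 2 * (2 * (H - t)) = c ^ 2).
  { intros t ht; rewrite <- (hr (U t)) by auto; now rewrite lU. }
  assert (rad : forall t, Rbar_interval aI bI t ->
    radius k P (U t) = radius_formula H c t).
  { intros t ht; apply radius_formula_eq; auto. }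
  exists c; split; [auto | split].
  { intros t ht; rewrite <- rad by auto; now destruct k. }
  intros hq.
  assert (tH : forall t, Rbar_interval aI bI t -> t < H)
    by (intros t ht; assert (h := hH t ht); lra).
  destruct (profile_angle k H c aJ bJ aI bI P N hM hN hW hL hH hc hr hq)
    as [s [F [hs [hF dPhi]]]].
  (* The angle up to a constant, as a function of [u]; composition with [U] turns it into a function
     of [t], since [lambda] at [U t] is [t]. *)
  set (g := fun u => s * (c ^ 2 / sqrt 2) * F (lambda k P N u 0)) in dPhi.
  assert (hg : forall t, Rbar_interval aI bI t -> g (U t) = s * (c ^ 2 / sqrt 2) * F t)
    by (intros t ht; unfold g; now rewrite lU).
  assert (hPhi : forall phi0,
    is_Phi1 (delta k) H c (Rbar_interval aI bI) (fun t => phi0 + g (U t))).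
  { intros phi0; exists phi0, s, F; split; [auto | split; [auto |]].
    intros t ht; now rewrite hg. }
  assert (dv := fun u hu => profile_coordinates_derive k 1 _ P u hM hu).
  assert (dS := fun u hu => profile_de_Sitter k P u (rs_de_Sitter _ _ _ _ hM u hu)).
  assert (dg : forall u, Rbar_interval aJ bJ u ->
    is_derive g u (- angular k P u / (radius k P u ^ 2 - delta k))) by exact dPhi.
  clear dPhi.
  destruct k; simpl radius in *; simpl delta in *; cbv beta iota in dv, dS.
  - assert (dg' : forall u, Rbar_interval aJ bJ u -> is_derive g u
      ((cz P u * Derive (cw P) u - cw P u * Derive (cz P) u) / (cz P u ^ 2 - cw P u ^ 2))).
    { intros u hu; evar_last; [apply dg; auto|].
      assert (y1 : cy P u ^ 2 - 1 <> 0).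
      { intros e; apply (proj1 (hq _ (hL u hu))); rewrite <- (hr u hu).
        replace (cy P u ^ 2) with 1 by lra; ring. }
      rewrite angular_eq; replace (cz P u ^ 2 - cw P u ^ 2) with (1 - cy P u ^ 2)
        by (assert (e := dS u hu); lra).
      field; split; lra. }
    (* [c ^ 2 - 2 * (H - t)] never vanishes, so the interval lies on one side of [H - c ^ 2 / 2];
       this separates [y < 1] from [1 < y]. *)
    assert (side : (forall t, Rbar_interval aI bI t -> t < H - c ^ 2 / 2) \/
      (forall t, Rbar_interval aI bI t -> H - c ^ 2 / 2 < t)).
    { destruct (constant_sign aI bI (fun t => t - (H - c ^ 2 / 2))) as [sg [[-> | ->] h]].
      - intros t ht; split.
        + apply derivable_continuous_pt; reg.
        + intros e; apply (proj1 (hq t ht)); replace t with (H - c ^ 2 / 2) by lra; field.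
      - right; intros t ht; assert (l := h t ht); lra.
      - left; intros t ht; assert (l := h t ht); lra. }
    destruct side as [inside|outside]; [left | right].
    + assert (y1 : forall u, Rbar_interval aJ bJ u -> cy P u ^ 2 < 1).
      { intros u hu; assert (e := hr u hu); assert (l := inside _ (hL u hu)).
        assert (p := pow_lt _ 2 hc); nra. }
      destruct (hyperbola_angle aJ bJ (cz P) (cw P) (Derive (cz P)) (Derive (cw P)) g u0 hu0)
        as [phi0 [sg [hsg hzw]]].
      { intros u hu; destruct (dv u hu) as [dz dw].
        assert (e := dS u hu); assert (l := y1 u hu).
        split; [lra | split; [exact dz | split; [exact dw | exact (dg' u hu)]]]. }
      exists (fun t => phi0 + g (U t)), sg; split; [apply hPhi | split; [auto | split; auto]].
      intros t ht; simpl; destruct (hzw (U t) (hUJ t ht)) as [ez ew].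
      replace (1 - cy P (U t) * (cy P (U t) * 1)) with (cz P (U t) ^ 2 - cw P (U t) ^ 2)
        by (assert (e := dS _ (hUJ t ht)); lra).
      auto.
    + assert (y1 : forall u, Rbar_interval aJ bJ u -> 1 < cy P u ^ 2).
      { intros u hu; assert (e := hr u hu); assert (l := outside _ (hL u hu)).
        assert (l' := tH _ (hL u hu)); nra. }
      (* For [1 < y] the positive quantity is [w ^ 2 - z ^ 2], so [z] and [w] exchange roles.
         Numerator and denominator of the angular velocity both change sign, and [g] still fits. *)
      destruct (hyperbola_angle aJ bJ (cw P) (cz P) (Derive (cw P)) (Derive (cz P)) g u0 hu0)
        as [phi0 [sg [hsg hwz]]].
      { intros u hu; destruct (dv u hu) as [dz dw].
        assert (e := dS u hu); assert (l := y1 u hu).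
        split; [lra | split; [exact dw | split; [exact dz |]]].
        evar_last; [exact (dg' u hu) | field; lra]. }
      exists (fun t => phi0 + g (U t)), sg; split; [apply hPhi | split; [auto | split]].
      * intros t ht; simpl; destruct (hwz (U t) (hUJ t ht)) as [ew ez].
        replace (cy P (U t) * (cy P (U t) * 1) - 1) with (cw P (U t) ^ 2 - cz P (U t) ^ 2)
          by (assert (e := dS _ (hUJ t ht)); lra).
        auto.
      * apply (sphere_outside_cases aI bI H c _ hc (hL u0 hu0)); auto.
        intros t ht; destruct (hq t ht); lra.
  (* On the hyperbolic surface [x ^ 2 + y ^ 2 = 1 + w ^ 2] is always positive, so a single circular
     angle covers the interval. *)
  - destruct (circle_angle aJ bJ (cx P) (cy P) (Derive (cx P)) (Derive (cy P)) g u0 hu0)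
      as [phi0 hxy].
    { intros u hu; destruct (dv u hu) as [dx dy].
      assert (e := dS u hu); assert (p := pow2_ge_0 (cw P u)).
      split; [lra | split; [exact dx | split; [exact dy |]]].
      evar_last; [exact (dg u hu)|].
      rewrite angular_eq; replace (cx P u ^ 2 + cy P u ^ 2) with (1 + cw P u ^ 2) by lra.
      field; lra. }
    exists (fun t => phi0 + g (U t)); split; [apply hPhi | split].
    + intros t ht; simpl; destruct (hxy (U t) (hUJ t ht)) as [ex ey].
      replace (1 + cw P (U t) * (cw P (U t) * 1)) with (cx P (U t) ^ 2 + cy P (U t) ^ 2)
        by (assert (e := dS _ (hUJ t ht)); lra).
      auto.
    + apply (hyperbolic_cases aI bI H c _ hc (hL u0 hu0)); auto.
      intros t ht; destruct (hq t ht); lra.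
  (* The parabolic angle is the affine quantity [x / z], whose derivative [- D / z ^ 2] is that of
     [g]; [phi0] is the constant difference, taken at [u0]. *)
  - set (phi0 := cx P u0 / cz P u0 - g u0).
    assert (hx : forall u, Rbar_interval aJ bJ u -> cx P u / cz P u - g u = phi0).
    { intros u hu.
      apply (constant_of_derive aJ bJ (fun s => cx P s * / cz P s - g s) u u0); auto.
      intros z hz; destruct (dv z hz) as [dx dz]; assert (p := rpos z hz).
      evar_last.
      - apply is_derive_Rminus; [apply is_derive_Rmult; [exact dx |] | exact (dg z hz)].
        apply (is_derive_inv (cz P) z _ dz); lra.
      - rewrite angular_eq; field; repeat split; nra. }
    exists (fun t => phi0 + g (U t)); split; [apply hPhi | split].
    + intros t ht; simpl; assert (p := rpos _ (hUJ t ht)).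
      repeat split; auto.
      * rewrite <- (hx _ (hUJ t ht)); field; lra.
      * assert (e := dS _ (hUJ t ht)).
        replace (1 - cx P (U t) * (cx P (U t) * 1)) with (2 * cz P (U t) * cw P (U t)) by lra.
        field; lra.
    + apply (parabolic_cases aI bI H c); auto.
      intros t ht; destruct (hq t ht); lra.
Qed.
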